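(* For every $0\le x\le1$, $$\inf_{\substack{A\subset[0,1)\ \text{measurable}\\ |A|=x}}\|S_1(\mathbbm 1_A)\|_1=T_3(x):=\sum_{j=0}^\infty 3^{-j}\psi_3(\{3^jx\}),$$ where $S_1$ is the one-variation for the ternary ($n=3$) filtration, $\{t\}=t-\lfloor t\rfloor$ is the fractional part of $t$, and $$\psi_3(t)=\min\left\{\frac{1+2|t-\frac12|}{3},\ \frac{2-4|t-\frac12|}{3}\right\},\qquad 0\le t\le1.$$ Moreover $B_{1,1,3}(x)=T_3(x)$ for every $x\in[0,1]$, and for $0<x<1$, $$T_3(x)\asymp x^*\log\frac1{x^*},\qquad x^*=\min\{x,1-x\},$$ i.e. there are absolute constants $0<c\le C<\infty$ such that $c\,x^*\log(1/x^* )\le T_3(x)\le C\,x^*\log(1/x^* )$ for all $x\in(0,1)$.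
   Context: $[0,1)$ carries Lebesgue measure and $|A|$ denotes the Lebesgue measure of $A$. For $m\ge0$, let $\mathcal I_m=\{[k/3^m,(k+1)/3^m):k=0,\dots,3^m-1\}$ and $\mathcal N_m=\sigma(\mathcal I_m)$. For $f\in L^1[0,1)$ put $f_m=\mathbb E(f\mid\mathcal N_m)$ for $m\ge0$, $d_m=f_m-f_{m-1}$ for $m\ge1$, and $S_1(f)=\sum_{m\ge1}|d_m|$ (value $+\infty$ allowed); $\|\cdot\|_1$ is the $L^1[0,1)$ norm (possibly $+\infty$). $\mathcal B(1,1,3)$ is the family of all continuous functions $F:[0,1]\to[0,\infty)$ with $F(0)=F(1)=0$ such that for all $x_1,x_2,x_3\in[0,1]$, with $\bar x=\frac{x_1+x_2+x_3}{3}$, $$F(\bar x)\le\frac13\sum_{i=1}^3F(x_i)+\frac13\sum_{i=1}^3|x_i-\bar x|.$$ $B_{1,1,3}(x):=\sup\{F(x):F\in\mathcal B(1,1,3)\}$. *)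

(* Defs.v *)
From HB Require Import structures.
From mathcomp Require Import all_boot all_order all_algebra.
From mathcomp Require Import all_classical all_reals all_analysis.
Import Order.TTheory GRing.Theory Num.Theory.
Import numFieldNormedType.Exports.

Set Implicit Arguments.
Unset Strict Implicit.
Unset Printing Implicit Defensive.

Local Open Scope classical_set_scope.
Local Open Scope ring_scope.

Section ConditionalExpectation.
Context d (T : measurableType d) (R : realType).
Variables (mu : {measure set T -> \bar R}) (D : set T) (N : set (set T)).

(* g is a version of E(f | N), where N is a sub-sigma-algebra on the measurable
   set D and D carries the restriction of mu. *)
Definition is_condexp (f g : T -> R) : Prop :=
  [/\ forall Y : set (measurableTypeR R), measurable Y -> N (D `&` g @^-1` Y),
      mu.-integrable D (EFin \o g) &
      forall A, N A ->
        (\int[mu]_(x in A) (g x)%:E = \int[mu]_(x in A) (f x)%:E)%E].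

(* A chosen version of E(f | N) (0 if there is none).  If N is generated by a
   finite partition of D into sets of positive finite measure, two versions
   agree at every point of D, not only almost everywhere. *)
Definition condexp (f : T -> R) : T -> R := xget (cst 0) (is_condexp f).

End ConditionalExpectation.

Section OneVariation.
Variable R : realType.

(* Lebesgue measure is taken on the Lebesgue (Caratheodory) sigma-algebra; the
   library's lebesgue_measure lives on the Borel sets only. *)
Local Notation leb := (@completed_lebesgue_measure R).

Definition lebesgue_measurable (A : set R) : Prop :=
  ((wlength idfun)^*)%mu.-cara.-measurable A.

Definition unit_itv : set R := `[0, 1[.

Definition triadic_itvs (m : nat) : set (set R) :=
  [set I | exists2 k : nat, (k < 3 ^ m)%N &
           I = `[k%:R / 3 ^+ m, k.+1%:R / 3 ^+ m[%classic].

Definition triadic_sigma (m : nat) : set (set R) :=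
  <<s unit_itv, triadic_itvs m >>.

Definition mart (f : R -> R) (m : nat) : R -> R :=
  condexp leb unit_itv (triadic_sigma m) f.

Definition mart_diff (f : R -> R) (m : nat) (x : R) : R :=
  mart f m x - mart f m.-1 x.

Definition S1 (f : R -> R) (x : R) : \bar R :=
  (\sum_(1 <= m <oo) `|mart_diff f m x|%:E)%E.

Definition norm1 (g : R -> \bar R) : \bar R :=
  (\int[leb]_(x in unit_itv) `|g x|)%E.

Definition inf_variation (x : R) : \bar R :=
  ereal_inf [set norm1 (S1 \1_A) | A in
    [set A : set R | [/\ lebesgue_measurable A, A `<=` unit_itv
                       & leb A = x%:E]]].

End OneVariation.

Section BellmanFamily.
Variable R : realType.

(* Members are functions on R; only their values on [0, 1] are constrained, and
   only these are used. *)
Definition B113_family : set (R -> R) :=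
  [set F : R -> R | [/\ {within `[0, 1 : R], continuous F},
               forall x : R, 0 <= x <= 1 -> 0 <= F x,
               F 0 = 0, F 1 = 0 &
               forall x : 'I_3 -> R, (forall i, 0 <= x i <= 1) ->
                 let xbar := (\sum_(i < 3) x i) / 3 in
                 F xbar <= 3^-1 * (\sum_(i < 3) F (x i))
                           + 3^-1 * (\sum_(i < 3) `|x i - xbar|)]].

Definition B113 (x : R) : \bar R := ereal_sup [set (F x)%:E | F in B113_family].

End BellmanFamily.

Section TakagiType.
Variable R : realType.

Definition frac (t : R) : R := t - (Num.floor t)%:~R.

Definition psi3 (t : R) : R :=
  Num.min ((1 + 2 * `|t - 2^-1|) / 3) ((2 - 4 * `|t - 2^-1|) / 3).

(* A series of nonnegative terms, summed in [0, +oo]. *)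
Definition T3 (x : R) : \bar R :=
  (\sum_(0 <= j <oo) (3 ^- j * psi3 (frac (3 ^+ j * x)))%:E)%E.

End TakagiType.

(* Main.v *)
(** T3 solves T(x) = psi3(x) + T({3x}) / 3, and psi3(x) is the cost
    (1/3) sum |x_i - x| of writing x as the mean of (3x, 0, 0), (1, 3x-1, 0) or
    (1, 1, 3x-2).  Splitting the initial segment [0, x) over its three children
    produces exactly these triples, so [0, x) has variation T3(x); and the
    Bellman inequality along these triples gives F - T3 <= (F - T3)({3x}) / 3 for
    F in the family, hence F <= T3 as F is bounded.

    The crux is that T3 satisfies the three-point inequality.  Put
    r_i = 3 x_i - k_i with ternary digits k_i.  By the functional equation the
    slack at (x_i) is one third of the slack at (r_i) plus an explicit piecewise
    linear term, in which no value of T3 remains.  This term can be negative, but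
    it is nonnegative for a slightly smaller deviation cost ("capped" below), so
    the infimum of the corresponding slack is at least a third of itself, hence
    nonnegative.  The piecewise linear inequality is checked by case analysis on
    integer triples over a common denominator, and T3 is continuous.

    For the lower bound, the mean of T3 over the densities of A in the cells of
    level m decreases by at most the L^1 norm of d_(m+1) when passing to level
    m + 1, equals T3(x) at level 0, and has infimum 0 because A is approximated
    in measure by unions of cells.

    The asymptotics follow from x log(1/x) = x log 3 + (3x) log(1/(3x)) / 3 by the
    same contraction argument. *)

Require Import Defs.
From Stdlib Require Import ZArith Lia.
From HB Require Import structures.
From mathcomp Require Import all_boot all_order all_algebra.
From mathcomp Require Import all_classical all_reals all_analysis.
From mathcomp Require Import measurable_realfun ssrZ ring lra.
Import Order.TTheory GRing.Theory Num.Theory.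
Import numFieldNormedType.Exports.

Local Open Scope classical_set_scope.
Local Open Scope ring_scope.
Local Notation frac := Defs.frac.
(* MathComp binds the key [Z] to [int_scope]. *)
Delimit Scope Z_scope with BinZ.

(** * The function [T3] *)

Section Takagi.
Context {R : realType}.
Implicit Types x y t : R.

Lemma min_cases x y :
  (Num.min x y = x /\ x <= y) \/ (Num.min x y = y /\ y <= x).
Proof. by case: (leP x y) => [|/ltW]; [left|right]. Qed.

Lemma exp3V_lt (e : R) : 0 < e -> exists n, 3 ^- n < e.
Proof.
move=> e0; have lim0 : (fun n => 3^-1 ^+ n : R) @ \oo --> 0.
  by apply: cvg_expr; rewrite ger0_norm ?invf_lt1 ?ltr1n.
have [n _ /(_ n (leqnn n)) ne] : \forall n \near \oo, 3^-1 ^+ n < e.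
  exact: (cvgr_lt _ lim0).
by exists n; rewrite -exprVn.
Qed.

(** Each use of the step divides the lower bound by 3, so induction gives [- |M| / 3 ^ n <= u z] for
    all [n]. This form covers an infimum equal to at least a third of itself, without forming the
    infimum. *)
Lemma contraction_ge0 (X : Type) (P : X -> Prop) (u : X -> R) (M : R) :
  (forall z, P z -> - M <= u z) ->
  (forall z, P z -> 0 <= u z \/ exists2 w, P w & u w <= 3 * u z) ->
  forall z, P z -> 0 <= u z.
Proof.
move=> uM step.
have H n : forall z, P z -> - (`|M| / 3 ^+ n) <= u z.
  elim: n => [|n IH] z Pz.
    by rewrite expr0 divr1; have := uM _ Pz; have := ler_norm M; lra.
  have [uz|[w Pw wz]] := step _ Pz.
    by apply: le_trans uz; rewrite oppr_le0 divr_ge0 ?exprn_ge0.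
  have := IH _ Pw; rewrite exprS invfM mulrCA.
  by set m := `|M| / _; lra.
move=> z Pz; rewrite leNgt; apply/negP => u0.
have M0 : 0 < `|M| + 1 by rewrite ltr_wpDl.
have e0 : 0 < - u z / (`|M| + 1) by rewrite divr_gt0// oppr_gt0.
have [n] := exp3V_lt _ e0; rewrite ltr_pdivlMr//.
have : 0 <= 3 ^- n :> R by rewrite invr_ge0 exprn_ge0.
by have := H n _ Pz; move: (3 ^- n) => q; lra.
Qed.

Lemma frac_itv x : 0 <= frac x < 1.
Proof. by have := floor_itv x; rewrite /frac intrD; lra. Qed.

Lemma fracDz x (k : int) : frac (x + k%:~R) = frac x.
Proof. by rewrite /frac floorDrz ?intr_int// intrKfloor intrD; ring. Qed.

Lemma psi3_ge0 t : 0 <= t <= 1 -> 0 <= psi3 t.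
Proof.
rewrite /psi3 le_min => /andP[t0 t1]; apply/andP.
by case: (lerP 0 (t - 2^-1)) => h; rewrite ?(ger0_norm h) ?(ltr0_norm h); split; lra.
Qed.

Lemma psi3_lower t : 0 <= t <= 3^-1 -> psi3 t = 4 / 3 * t.
Proof.
by move=> /andP[? ?]; rewrite /psi3 ler0_norm; [rewrite minEle; case: lerP => ?; lra|lra].
Qed.

Lemma psi3_upper t : 2 / 3 <= t <= 1 -> psi3 t = 4 / 3 * (1 - t).
Proof.
by move=> /andP[? ?]; rewrite /psi3 ger0_norm; [rewrite minEle; case: lerP => ?; lra|lra].
Qed.

(** The right endpoint is allowed because [psi3] takes the same value 0 at 0 and at 1. *)
Lemma psi3_frac (k : int) x : k%:~R <= x <= k%:~R + 1 ->
  psi3 (frac x) = psi3 (x - k%:~R).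
Proof.
move=> /andP[kx]; rewrite le_eqVlt => /orP[/eqP ->|xk].
  rewrite (_ : frac _ = 0); last by rewrite -(intrD _ k 1) /frac intrKfloor subrr.
  by rewrite addrAC subrr add0r psi3_lower ?psi3_upper; lra.
by rewrite /frac (_ : Num.floor x = k)//; apply: floor_def; rewrite kx intrD.
Qed.

Lemma psi3_frac01 x : 0 <= x <= 1 -> psi3 (frac x) = psi3 x.
Proof. by move=> x01; rewrite (@psi3_frac 0) ?mulr0z ?add0r ?subr0. Qed.

Lemma psi3_middle t : 3^-1 <= t <= 2 / 3 -> psi3 t = (1 + 2 * `|t - 2^-1|) / 3.
Proof.
move=> /andP[? ?]; rewrite /psi3 minEle.
by case: (lerP 0 (t - 2^-1)) => h; rewrite ?(ger0_norm h) ?(ltr0_norm h);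
  case: lerP => ?; lra.
Qed.

(** The two branches of the minimum cross at [|t - 1/2| = 1/6], with common value [4/9]. *)
Lemma psi3_le t : 0 <= t <= 1 -> psi3 t <= 4 / 9.
Proof.
rewrite /psi3 ge_min => /andP[? ?].
case: (lerP 0 (t - 2^-1)) => h; rewrite ?(ger0_norm h) ?(ltr0_norm h); apply/orP; 
 have [|] := lerP `|t - 2^-1| 6^-1; rewrite ?(ger0_norm h) ?(ltr0_norm h); by [left; lra|right; lra|lra].
Qed.

Lemma psi3_fracN x : psi3 (frac (- x)) = psi3 (frac x).
Proof.
have /andP[x0 x1] := frac_itv x.
rewrite (@psi3_frac (- Num.floor x - 1) (- x)).
  rewrite /psi3 (_ : - x - _ - 2^-1 = - (frac x - 2^-1)) ?normrN//.
  by rewrite /frac intrB mulrNz; lra.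
by move: x0 x1; rewrite /frac intrB mulrNz; lra.
Qed.

Definition takagi x : R := fine (T3 x).

Let term_ge0 x j : (0 <= (3 ^- j * psi3 (frac (3 ^+ j * x)))%:E)%E.
Proof.
rewrite lee_fin mulr_ge0 ?invr_ge0 ?exprn_ge0// psi3_ge0//.
by have /andP[-> /ltW] := frac_itv (3 ^+ j * x).
Qed.

Lemma T3_ge0 x : (0 <= T3 x)%E.
Proof. by apply: nneseries_ge0 => j _ _; exact: term_ge0. Qed.

Lemma T3_le x : (T3 x <= (2 / 3)%:E)%E.
Proof.
apply: lime_le; first by apply: is_cvg_nneseries => *; exact: term_ge0.
apply: nearW => n; rewrite sumEFin lee_fin.
(* [4/9] times the geometric sum of [3 ^- j] over [j < n] is [2/3 (1 - 3 ^- n)], a bound that passes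
   through the induction. *)
suff : \sum_(0 <= j < n) 3 ^- j * psi3 (frac (3 ^+ j * x)) <= 2 / 3 * (1 - 3 ^- n).
  have : 0 <= 3 ^- n :> R by rewrite invr_ge0 exprn_ge0.
  lra.
elim: n => [|n IH]; first by rewrite big_geq// expr0 invr1; lra.
rewrite big_nat_recr//= exprS invfM.
have /andP[h0 h1] := frac_itv (3 ^+ n * x).
have := @psi3_le (frac (3 ^+ n * x)); rewrite h0 ltW// => /(_ isT).
have : 0 <= 3 ^- n :> R by rewrite invr_ge0 exprn_ge0.
move: IH; set z := 3 ^- n; set s := \sum_(_ <= _ < _) _; set p := psi3 _; nra.
Qed.

Lemma T3E x : T3 x = (takagi x)%:E.
Proof.
rewrite fineK// ge0_fin_numE ?T3_ge0//; exact: le_lt_trans (T3_le x) (ltry _).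
Qed.

Lemma takagi_ge0 x : 0 <= takagi x.
Proof. by rewrite -lee_fin -T3E T3_ge0. Qed.

Lemma takagi_le x : takagi x <= 2 / 3.
Proof. by rewrite -lee_fin -T3E T3_le. Qed.

Lemma takagi_rec x : takagi x = psi3 (frac x) + takagi (3 * x) / 3.
Proof.
apply: EFin_inj; rewrite -T3E EFinD mulrC EFinM -T3E /T3 nneseries_recl// expr0 invr1 !mul1r.
congr (_ + _)%E; rewrite -nneseries_addn// -nneseriesZl//.
apply: eq_eseriesr => j _.
by rewrite addn1 -EFinM; congr (_%:E); rewrite !mulrA -invfM -exprS -exprSr.
Qed.

Lemma takagiDz x (k : int) : takagi (x + k%:~R) = takagi x.
Proof.
rewrite /takagi /T3; congr fine; apply: eq_eseriesr => j _.
have -> : 3 ^+ j * (x + k%:~R) = 3 ^+ j * x + (3 ^+ j * k)%:~R.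
  by rewrite mulrDr intrM rmorphXn.
by rewrite fracDz.
Qed.

Lemma takagiN x : takagi (- x) = takagi x.
Proof.
by rewrite /takagi /T3; congr fine; apply: eq_eseriesr => j _; rewrite mulrN psi3_fracN.
Qed.

Lemma takagi_sym x : takagi (1 - x) = takagi x.
Proof. by rewrite addrC -[1]/(1%:~R) takagiDz takagiN. Qed.

Lemma takagi0 : takagi 0 = 0.
Proof.
have h : psi3 0 = 0 :> R by rewrite psi3_lower; lra.
by have := takagi_rec 0; rewrite psi3_frac01 ?lexx ?ler01// h mulr0; lra.
Qed.

Lemma takagi1 : takagi 1 = 0.
Proof. by rewrite -takagi_sym subrr takagi0. Qed.

(** By periodicity any integer may be subtracted, so a point on the border of two thirds may be
    given either digit. *)
Lemma takagi_digit (k : int) x : 0 <= x <= 1 -> 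
  takagi x = psi3 x + takagi (3 * x - k%:~R) / 3.
Proof.
move=> x01; rewrite takagi_rec psi3_frac01//.
by rewrite -(takagiDz (3 * x - _) k) subrK.
Qed.

Lemma psi3_frac_lip x y : `|psi3 (frac x) - psi3 (frac y)| <= 4 / 3 * `|x - y|.
Proof.
wlog xy : x y / x <= y => [H|].
  by have /orP[/H//|/H] := le_total x y; rewrite distrC (distrC y).
have h t : 0 <= t <= 1 -> psi3 t <= 4 / 3 * t /\ psi3 t <= 4 / 3 * (1 - t).
  by move=> /andP[? ?]; rewrite /psi3 !ge_min; split; apply/orP; right;
   case: (lerP 0 (t - 2^-1)) => h; rewrite ?(ger0_norm h) ?(ltr0_norm h); lra.
have /andP[x0 x1] := frac_itv x; have /andP[y0 y1] := frac_itv y.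
have [e|ne] := eqVneq (Num.floor x) (Num.floor y).
  rewrite (_ : x - y = frac x - frac y); last by rewrite /frac e opprB addrA subrK.
  rewrite /psi3; have := ler_dist_dist (frac x - 2^-1) (frac y - 2^-1).
  rewrite (_ : frac x - 2^-1 - (frac y - 2^-1) = frac x - frac y); last by ring.
  move: `|frac x - 2^-1| `|frac y - 2^-1| `|frac x - frac y| => u v w.
  rewrite ler_norml => /andP[? ?]; rewrite ler_norml; apply/andP.
  case: (min_cases ((1 + 2 * u) / 3) ((2 - 4 * u) / 3)) => -[-> ?];
  by case: (min_cases ((1 + 2 * v) / 3) ((2 - 4 * v) / 3)) => -[-> ?]; split; lra.
(* Here integers lie between [x] and [y]. Both values are nonnegative and at most [4/3] times the
   distance to such an integer, so their difference is at most [4/3 |x - y|]. *)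
have lt : (Num.floor x + 1)%:~R <= (Num.floor y)%:~R :> R.
  by rewrite ler_int lezD1 lt_neqAle ne le_floor.
rewrite intrD in lt.
have [_ hx] := h _ (introT andP (conj x0 (ltW x1))).
have [hy _] := h _ (introT andP (conj y0 (ltW y1))).
have px := @psi3_ge0 (frac x); rewrite x0 ltW// in px; have {}px := px isT.
have py := @psi3_ge0 (frac y); rewrite y0 ltW// in py; have {}py := py isT.
rewrite [X in _ <= _ * X]ler0_norm ?subr_le0// ler_norml.
by move: hx hy; rewrite {2}/frac {4}/frac; move: x0 y1; rewrite /frac; move=> *; apply/andP; split; lra.
Qed.

(** Each of the first [n] terms is [4/3]-Lipschitz, as the factor [3 ^- j] cancels the dilation by
    [3 ^ j]; the tail oscillates by at most [3 ^- n]. This serves both for continuity and for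
    [potential_small]. *)
Lemma takagi_modulus n x y : `|takagi x - takagi y| <= 4 / 3 * n%:R * `|x - y| + 3 ^- n.
Proof.
elim: n x y => [|n IH] x y.
  rewrite mulr0 mul0r add0r expr0 invr1 ler_norml.
  have := takagi_ge0 x; have := takagi_ge0 y; have := takagi_le x; have := takagi_le y.
  by move=> *; apply/andP; split; lra.
rewrite takagi_rec (takagi_rec y) opprD addrACA -mulrBl.
apply: le_trans (ler_normD _ _) _; rewrite normrM [`|3^-1|]ger0_norm//.
have := psi3_frac_lip x y; have := IH (3 * x) (3 * y).
rewrite -mulrBr normrM [`|3|]ger0_norm// exprS invfM -(natr1 n).
move: `|psi3 _ - _| `|takagi _ - _| `|x - y| (3 ^+ n)^-1 (n%:R) => p t d z m; nra.
Qed.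

End Takagi.

(** * The three-point inequality *)

Section IntegerCost.
Local Open Scope Z_scope.
Variable N : Z.
Implicit Types a b c n k e f j s U V : Z.

(* [9 N psi3(n / (3 N))]. *)
Definition psiZ n :=
  Z.min (Z.min (4 * n) (12 * N - 4 * n)) (3 * N + Z.abs (2 * n - 3 * N)).

(** First ternary digit of [n / (3 N)]. The endpoint 1 gets the digit 2 and the remainder 1, so
    remainders stay in the closed unit interval. *)
Definition digit n k : Prop :=
  (k = 0 /\ 0 <= n < N) \/ (k = 1 /\ N <= n < 2 * N) \/ (k = 2 /\ 2 * N <= n <= 3 * N).

(* For [a <= b <= c] the deviation cost [|3a-s| + |3b-s| + |3c-s|] of the triple
   [(a, b, c) / N] is [2 max (s - 3a, 3c - s)].  With that cost the slack of the
   three-point inequality is not contracted by the step to ternary remainders;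
   with the smaller cost [2 capped a b c] it is. *)
Definition capped a b c :=
  let s := a + b + c in
  Z.max (Z.min (s - 3 * a) (Z.max (3 * c - s) N + Z.max 0 (2 * s - 3 * N)))
   (Z.min (3 * c - s) (Z.max (s - 3 * a) N + Z.max 0 (3 * N - 2 * s))).

Lemma psiZ0 n : 0 <= n < N -> psiZ n = 4 * n. Proof. unfold psiZ; lia. Qed.
Lemma psiZ1 n : N <= n < 2 * N -> psiZ n = 3 * N + Z.abs (2 * n - 3 * N). Proof. unfold psiZ; lia. Qed.
Lemma psiZ2 n : 2 * N <= n <= 3 * N -> psiZ n = 12 * N - 4 * n. Proof. unfold psiZ; lia. Qed.

Definition perm3 x y z a b c : Prop :=
 x = a /\ y = b /\ z = c \/ x = a /\ y = c /\ z = b \/ x = b /\ y = a /\ z = c \/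
 x = b /\ y = c /\ z = a \/ x = c /\ y = a /\ z = b \/ x = c /\ y = b /\ z = a.

Ltac psi_eq := repeat match goal with
  | |- context [psiZ ?n] => first [rewrite (@psiZ0 n); [|lia]
      | rewrite (@psiZ1 n); [|lia] | rewrite (@psiZ2 n); [|lia]]
  end.

(** The sign of [3b - s] decides which of the deviations [s - 3a] and [3c - s] is the larger.
    [capped_ineq] uses [capped] only through these lower bounds at the source triple and through
    [capped_upper] at the remainders, so both values become opaque numbers there. *)
Lemma capped_lower a b c : a <= b -> b <= c -> 2 * (a + b + c) <= 3 * N ->
  let s := a + b + c in
  s <= 3 * b /\ (s - 3 * a <= capped a b c \/ 3 * c - s <= capped a b c /\ N <= capped a b c) \/
  3 * b <= s /\ (3 * c - s <= capped a b c \/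
    4 * N - 2 * s <= capped a b c /\ 3 * N - s - 3 * a <= capped a b c).
Proof. unfold capped; lia. Qed.

(** [p] and [q] are the two inner maxima, each recorded with the argument it equals, so that the
    choice between the arguments can be postponed in [capped_ineq]. *)
Lemma capped_upper x y z (s := x + y + z) : x <= y -> y <= z ->
  (capped x y z <= s - 3 * x /\ exists p q, capped x y z <= p + q /\
     (p = N \/ p = 3 * z - s) /\ (q = 0 \/ q = 2 * s - 3 * N)) \/
  (capped x y z <= 3 * z - s /\ exists p q, capped x y z <= p + q /\
     (p = N \/ p = s - 3 * x) /\ (q = 0 \/ q = 3 * N - 2 * s)).
Proof.
intros xy yz; destruct (Z.le_ge_cases s (3 * y)) as [sy|sy]; [left|right];
  (split; [unfold capped, s in *; lia|]).
- exists (Z.max (3 * z - s) N), (Z.max 0 (2 * s - 3 * N)); unfold capped, s in *; lia.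
- exists (Z.max (s - 3 * x) N), (Z.max 0 (3 * N - 2 * s)); unfold capped, s in *; lia.
Qed.

(* The contraction step [slack (x, y, z) <= 3 slack (a, b, c)] below, after all
   values of [T3] have cancelled. *)
Lemma capped_ineq a b c k1 k2 k3 j x y z : 0 < N -> 0 <= a -> a <= b -> b <= c -> c <= N ->
  2 * (a + b + c) <= 3 * N ->
  digit (3 * a) k1 -> digit (3 * b) k2 -> digit (3 * c) k3 ->
  digit (3 * (a + b + c) - (k1 + k2 + k3) * N) j ->
  x <= y -> y <= z -> perm3 x y z (3 * a - k1 * N) (3 * b - k2 * N) (3 * c - k3 * N) ->
  exists e f, digit (a + b + c) e /\ digit (3 * ((a + b + c) - e * N)) f /\
   k1 + k2 + k3 + j = 3 * e + f /\
   2 * capped x y z - psiZ (3 * (a + b + c) - (k1 + k2 + k3) * N) <=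
   psiZ (3 * a) + psiZ (3 * b) + psiZ (3 * c) + 6 * capped a b c
   - 3 * psiZ (a + b + c) - psiZ (3 * ((a + b + c) - e * N)).
Proof.
intros N0 a0 ab bc cN sN d1 d2 d3 d4.
destruct d1 as [[-> ?]|[[-> ?]|[-> ?]]];
destruct d2 as [[-> ?]|[[-> ?]|[-> ?]]]; try lia;
destruct d3 as [[-> ?]|[[-> ?]|[-> ?]]]; try lia;
destruct d4 as [[-> ?]|[[-> ?]|[-> ?]]]; try (exfalso; lia);
intros xy yz pm; unfold digit;
(* [e] and [f] are the first two ternary digits of the mean. Its ninefold is [k1 + k2 + k3] plus
   three times the mean of the remainders, which gives the carry equation. The mean is at most
   [1/2], so [3 e + f] is at most 4 and five pairs remain. *)
let t u v := (exists u, v; split; [lia|split; [lia|split; [lia|]]]) in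
first [t 0 0 | t 0 1 | t 0 2 | t 1 0 | t 1 1].
all: psi_eq.
all: pose proof (capped_lower a b c ab bc sN) as hl; cbv zeta in hl.
all: pose proof (capped_upper x y z xy yz) as hu.
all: generalize dependent (capped x y z); generalize dependent (capped a b c).
all: intros V hl U hu.
all: destruct hl as [[? [hl|hl]]|[? [hl|hl]]]; destruct hu as [[? hu]|[? hu]];
  destruct pm as [pm|[pm|[pm|[pm|[pm|pm]]]]]; destruct pm as [? [? ?]]; subst x y z.
all: try lia.
all: destruct hu as [p [q [h [[e|e] [f|f]]]]]; lia.
Qed.
End IntegerCost.

(** * The three-point inequality for rationals with a common denominator *)

Section ThreePoint.
Context {R : realType}.
Implicit Types (a b c n k N : Z).

Definition zr (z : Z) : R := (int_of_Z z)%:~R.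

Lemma zrD a b : zr (a + b)%BinZ = zr a + zr b.
Proof. by rewrite /zr -intrD -[in RHS]raddfD. Qed.
Lemma zrB a b : zr (a - b)%BinZ = zr a - zr b.
Proof. by rewrite /zr -intrB -[in RHS]raddfB. Qed.
Lemma zrM a b : zr (a * b)%BinZ = zr a * zr b.
Proof. by rewrite /zr -intrM -[in RHS]rmorphM. Qed.

Lemma zr_le a b : (a <= b)%BinZ -> zr a <= zr b.
Proof.
rewrite -Z.le_0_sub -subr_ge0 -zrB ler0z.
by case: (b - a)%BinZ => [//|//|p] /(_ erefl).
Qed.

Lemma zr_lt a b : (a < b)%BinZ -> zr a < zr b.
Proof.
move=> ab; have h : (a + 1 <= b)%BinZ by lia.
by have := zr_le _ _ h; rewrite zrD; have : zr 1 = 1 by []; lra.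
Qed.

Lemma zr_abs a : zr (Z.abs a) = `|zr a|.
Proof.
have z0 : zr 0 = 0 by [].
have [h|h] := Z.le_gt_cases 0 a.
  by rewrite Z.abs_eq// ger0_norm// -z0 zr_le.
by rewrite Z.abs_neq ?ler0_norm -?z0 ?zr_le//; try lia; rewrite -(Z.sub_0_l a) zrB z0 sub0r.
Qed.

Definition zrE := (zrD, zrB, zrM).

Lemma psiZ_psi3 N n k : (0 < N)%BinZ -> digit N n k ->
  zr (psiZ N n) = 9 * zr N * psi3 (zr n / (3 * zr N)).
Proof.
move=> /zr_lt N0 d; have {N0} : 0 < zr N by [].
have e3 : zr 3 = 3 by []; have e2 : zr 2 = 2 by [].
have e4 : zr 4 = 4 by []; have e12 : zr 12 = 12 by [].
have hd (x y : R) : 0 < zr N -> (x <= y / (3 * zr N)) = (x * (3 * zr N) <= y).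
  by move=> N0; rewrite ler_pdivlMr// mulr_gt0.
have hd' (x y : R) : 0 < zr N -> (y / (3 * zr N) <= x) = (y <= x * (3 * zr N)).
  by move=> N0; rewrite ler_pdivrMr// mulr_gt0.
move=> N0; have Nn : zr N != 0 by rewrite gt_eqF.
case: d => [[_ h]|[[_ h]|[_ h]]].
- rewrite psiZ0// zrM e4 psi3_lower; first by field.
  have /zr_le h0 : (0 <= n)%BinZ by lia.
  have /zr_le h1 : (n <= N)%BinZ by lia.
  by rewrite hd ?hd'// mul0r; apply/andP; split => //; lra.
- rewrite psiZ1// zrD zrM zr_abs zrB !zrM e3 e2.
  have /zr_le h0 : (N <= n)%BinZ by lia.
  have /zr_le h1 : (n <= 2 * N)%BinZ by lia.
  rewrite zrM e2 in h1.
  rewrite psi3_middle; last by rewrite hd ?hd'//; apply/andP; split => //; lra.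
  have -> : zr n / (3 * zr N) - 2^-1 = (2 * zr n - 3 * zr N) * (6 * zr N)^-1 by field.
  rewrite normrM [`|(_ * _)^-1|]ger0_norm; last by rewrite invr_ge0 mulr_ge0// ltW.
  by move: `|_| => w; field.
- rewrite psiZ2// zrB !zrM e4 e12 psi3_upper; first by field.
  have /zr_le h0 : (2 * N <= n)%BinZ by lia.
  have /zr_le h1 : (n <= 3 * N)%BinZ by lia.
  rewrite !zrM e2 e3 in h0 h1.
  by rewrite hd ?hd'//; apply/andP; split => //; lra.
Qed.

Section FixedDenominator.
Variable N : Z.
Hypothesis N0 : (0 < N)%BinZ.

Lemma zN0 : 0 < zr N. Proof. exact: (zr_lt _ _ N0). Qed.

(** The scaling is that of [psiZ], so the functional equation has integer inhomogeneous term. *)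
Definition tgrid n : R := 9 * zr N * takagi (zr n / (3 * zr N)).

Lemma tgrid_digit n k : digit N n k ->
  tgrid n = zr (psiZ N n) + tgrid (3 * n - 3 * k * N)%BinZ / 3.
Proof.
move=> d; rewrite (psiZ_psi3 _ _ _ N0 d) /tgrid (takagi_digit (int_of_Z k)).
  rewrite mulrDr !zrE (_ : zr 3 = 3)//.
  have -> : (3 * zr n - 3 * zr k * zr N) / (3 * zr N) = 3 * (zr n / (3 * zr N)) - zr k.
    by field; rewrite gt_eqF ?zN0.
  by rewrite -[X in _ = _ + X]mulrA.
have /zr_le h0 : (0 <= n)%BinZ by case: d => [|[]]; lia.
have /zr_le h1 : (n <= 3 * N)%BinZ by case: d => [|[]]; lia.
rewrite zrM (_ : zr 3 = 3)// in h1.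
by rewrite divr_ge0 ?mulr_ge0 ?(ltW zN0)//= ler_pdivrMr ?mulr_gt0 ?zN0// mul1r.
Qed.

Lemma tgrid_sym n : tgrid (3 * N - n)%BinZ = tgrid n.
Proof.
rewrite /tgrid -[in RHS]takagi_sym !zrE (_ : zr 3 = 3)//; congr (_ * takagi _).
by field; rewrite gt_eqF ?zN0.
Qed.

(** [27 N] times the slack of the three-point inequality at [(a, b, c) / N], with the deviation cost
    [6 max (s - 3a, 3c - s)], where [s = a + b + c], lowered to [6 capped N a b c]. *)
Definition slack a b c : R :=
  tgrid (3 * a)%BinZ + tgrid (3 * b)%BinZ + tgrid (3 * c)%BinZ
  + zr (6 * capped N a b c) - 3 * tgrid (a + b + c)%BinZ.

Definition sorted3 '(a, b, c) := (0 <= a /\ a <= b /\ b <= c /\ c <= N)%BinZ.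

Lemma exists_digit n : (0 <= n <= 3 * N)%BinZ -> exists k, digit N n k.
Proof.
move=> h; have [?|?] := Z.lt_ge_cases n N; first by exists 0%BinZ; left; lia.
have [?|?] := Z.lt_ge_cases n (2 * N); first by exists 1%BinZ; right; left; lia.
by exists 2%BinZ; right; right; lia.
Qed.

Lemma exists_sort3 a b c : exists x y z, (x <= y /\ y <= z)%BinZ /\ perm3 x y z a b c.
Proof.
rewrite /perm3.
have [|] := Z.le_ge_cases a b; have [|] := Z.le_ge_cases b c; have [|] := Z.le_ge_cases a c => *.
all: first [exists a, b, c; split; [lia|tauto] | exists a, c, b; split; [lia|tauto]
 | exists b, a, c; split; [lia|tauto] | exists b, c, a; split; [lia|tauto]
 | exists c, a, b; split; [lia|tauto] | exists c, b, a; split; [lia|tauto]].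
Qed.

Lemma perm3_sum (f : Z -> R) x y z a b c : perm3 x y z a b c ->
  f x + f y + f z = f a + f b + f c.
Proof. by case=> [|[|[|[|[|]]]]] [-> [-> ->]]; ring. Qed.

Lemma slack_step a b c : sorted3 (a, b, c) -> (2 * (a + b + c) <= 3 * N)%BinZ ->
  exists x y z, sorted3 (x, y, z) /\ slack x y z <= 3 * slack a b c.
Proof.
move=> [a0 [ab [bc cN]]] sN.
have [k1 d1] := exists_digit (3 * a)%BinZ ltac:(lia).
have [k2 d2] := exists_digit (3 * b)%BinZ ltac:(lia).
have [k3 d3] := exists_digit (3 * c)%BinZ ltac:(lia).
have r1 : (0 <= 3 * a - k1 * N <= N)%BinZ by case: d1 => [|[]] [-> ?]; lia.
have r2 : (0 <= 3 * b - k2 * N <= N)%BinZ by case: d2 => [|[]] [-> ?]; lia.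
have r3 : (0 <= 3 * c - k3 * N <= N)%BinZ by case: d3 => [|[]] [-> ?]; lia.
have [j dj] := exists_digit (3 * (a + b + c) - (k1 + k2 + k3) * N)%BinZ ltac:(lia).
have [x [y [z [[xy yz] p]]]] :=
  exists_sort3 (3 * a - k1 * N)%BinZ (3 * b - k2 * N)%BinZ (3 * c - k3 * N)%BinZ.
exists x, y, z; split.
  by case: p => [|[|[|[|[|]]]]] [-> [-> ->]] in xy yz *; rewrite /sorted3; lia.
have [e [f [de [df [kef ineq]]]]] :=
  capped_ineq N a b c k1 k2 k3 j x y z N0 a0 ab bc cN sN d1 d2 d3 dj xy yz p.
have s : (x + y + z = 3 * (a + b + c) - (k1 + k2 + k3) * N)%BinZ.
  by case: p => [|[|[|[|[|]]]]] [-> [-> ->]]; ring.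
rewrite /slack s (perm3_sum (fun n => tgrid (3 * n)%BinZ) _ _ _ _ _ _ p).
rewrite (tgrid_digit _ _ d1) (tgrid_digit _ _ d2) (tgrid_digit _ _ d3).
rewrite (tgrid_digit _ _ dj) (tgrid_digit _ _ de).
have -> : (3 * (a + b + c) - 3 * e * N = 3 * (a + b + c - e * N))%BinZ by ring.
rewrite (tgrid_digit _ _ df).
(* The functional equation was applied twice at the mean and once at the mean of the remainders. By
   the carry equation both lead to the same argument, so these values of [tgrid] cancel and
   [capped_ineq] is what is left. *)
have -> : (3 * (3 * (a + b + c) - (k1 + k2 + k3) * N) - 3 * j * N =
  3 * (3 * (a + b + c - e * N)) - 3 * f * N)%BinZ by nia.
have := zr_le _ _ ineq; rewrite ![zr (6 * _)]zrM !zrE.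
have -> : (3 * (3 * a) - 3 * k1 * N = 3 * (3 * a - k1 * N))%BinZ by ring.
have -> : (3 * (3 * b) - 3 * k2 * N = 3 * (3 * b - k2 * N))%BinZ by ring.
have -> : (3 * (3 * c) - 3 * k3 * N = 3 * (3 * c - k3 * N))%BinZ by ring.
rewrite (_ : zr 2 = 2)// (_ : zr 3 = 3)// (_ : zr 6 = 6)//.
lra.
Qed.

(** The reflection [x -> 1 - x] reduces the contraction to triples with mean at most [1/2], the
    range of [capped_ineq]. *)
Lemma slack_sym a b c : slack (N - c)%BinZ (N - b)%BinZ (N - a)%BinZ = slack a b c.
Proof.
rewrite /slack.
have -> : capped N (N - c) (N - b) (N - a) = capped N a b c by rewrite /capped; lia.
have t n : tgrid (3 * (N - n))%BinZ = tgrid (3 * n)%BinZ.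
  by rewrite -tgrid_sym; congr tgrid; ring.
have -> : (N - c + (N - b) + (N - a) = 3 * N - (a + b + c))%BinZ by ring.
by rewrite !t tgrid_sym; ring.
Qed.

Lemma slack_ge0 t : sorted3 t -> let '(a, b, c) := t in 0 <= slack a b c.
Proof.
pose u (t : Z * Z * Z) : R := let '(a, b, c) := t in slack a b c.
suff H : forall t, sorted3 t -> 0 <= u t by move=> /H; case: t => -[].
(* The only negative term of [slack] is [- 3 tgrid], and [3 * 9 N * 2/3 = 18 N]. *)
apply: (@contraction_ge0 _ _ _ _ (18 * zr N)) => -[[a b] c] st.
  move: (st) => [a0 [ab [bc cN]]].
  have t0 n : 0 <= tgrid n by rewrite /tgrid !mulr_ge0 ?takagi_ge0 ?(ltW zN0).
  have t1 : tgrid (a + b + c)%BinZ <= 6 * zr N.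
    rewrite /tgrid; have := takagi_le (zr (a + b + c)%BinZ / (3 * zr N)).
    by have := zN0; move: (takagi _) => w; nra.
  have /zr_le c0 : (0 <= 6 * capped N a b c)%BinZ by rewrite /capped; lia.
  have := t0 (3 * a)%BinZ; have := t0 (3 * b)%BinZ; have := t0 (3 * c)%BinZ; rewrite /u /slack.
  by move: c0; rewrite (_ : zr 0 = 0)//; lra.
right; have [sN|sN] := Z.le_ge_cases (2 * (a + b + c)) (3 * N).
  by have [x [y [z [? ?]]]] := slack_step a b c st sN; exists (x, y, z).
have st' : sorted3 (N - c, N - b, N - a)%BinZ by move: st; rewrite /sorted3; lia.
have [x [y [z [? ?]]]] := slack_step _ _ _ st' ltac:(lia).
by exists (x, y, z) => //; rewrite /u -(slack_sym a b c).
Qed.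

Lemma tgrid_three_point a b c : (0 <= a <= N)%BinZ -> (0 <= b <= N)%BinZ -> (0 <= c <= N)%BinZ ->
  3 * tgrid (a + b + c)%BinZ <= tgrid (3 * a)%BinZ + tgrid (3 * b)%BinZ + tgrid (3 * c)%BinZ +
   3 * (`|zr (3 * a - (a + b + c))| + `|zr (3 * b - (a + b + c))| + `|zr (3 * c - (a + b + c))|).
Proof.
move=> a1 b1 c1; have [x [y [z [[xy yz] p]]]] := exists_sort3 a b c.
have s : (x + y + z = a + b + c)%BinZ by case: p => [|[|[|[|[|]]]]] [-> [-> ->]]; ring.
have st : sorted3 (x, y, z).
  by case: p => [|[|[|[|[|]]]]] [-> [-> ->]] in xy yz *; rewrite /sorted3; lia.
have := slack_ge0 _ st; rewrite /slack s.
rewrite (perm3_sum (fun n => tgrid (3 * n)%BinZ) _ _ _ _ _ _ p).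
rewrite -!zr_abs.
rewrite -(perm3_sum (fun n => zr (Z.abs (3 * n - (a + b + c)))) _ _ _ _ _ _ p) -s.
have h : (6 * capped N x y z <= 3 * (Z.abs (3 * x - (x + y + z)) +
    Z.abs (3 * y - (x + y + z)) + Z.abs (3 * z - (x + y + z))))%BinZ.
  by rewrite /capped; lia.
have := zr_le _ _ h; rewrite ![zr (3 * (_ + _ + _))]zrM !zrD (_ : zr 3 = 3)//.
lra.
Qed.

End FixedDenominator.
End ThreePoint.

(** * Continuity and the passage to real triples *)

Section ThreePointReal.
Context {R : realType}.
Implicit Types a b c x y : R.

Lemma continuous_takagi : continuous (@takagi R).
Proof.
move=> x; apply/cvgrPdist_lt => e e0.
have [n ne] := exp3V_lt (e / 2) ltac:(by rewrite divr_gt0).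
(* The radius makes the Lipschitz part [4/3 n |x - y|] of the modulus less than [e / 2]; the summand
   1 keeps the denominator positive at [n = 0]. *)
have d0 : 0 < e / (8 / 3 * n%:R + 1) by rewrite divr_gt0// ltr_wpDl// mulr_ge0.
near=> y; apply: le_lt_trans (takagi_modulus n x y) _.
have : `|x - y| < e / (8 / 3 * n%:R + 1) by near: y; apply: cvgr_dist_lt.
rewrite ltr_pdivlMr ?ltr_wpDl ?mulr_ge0//; have := normr_ge0 (x - y).
by move: ne; move: `|x - y| (3 ^- n) n%:R => d z m; lra.
Unshelve. all: by end_near. Qed.

(** Rounding down gives the three points one common denominator and keeps them in the unit interval;
    the mean is then taken of the rounded points. *)
Let floor_grid x (n : nat) : R := (Num.floor (n.+1%:R * x))%:~R / n.+1%:R.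

Let floor_grid_cvg x : floor_grid x @ \oo --> x.
Proof.
have h : (fun n => x - harmonic n) @ \oo --> x.
  by rewrite -[X in _ --> X]subr0; apply: cvgB; [exact: cvg_cst|exact: cvg_harmonic].
apply: (squeeze_cvgr _ h (cvg_cst x)); apply: nearW => n.
rewrite /floor_grid ler_pdivlMr// ler_pdivrMr// mulrBl mulVf// [x * _]mulrC.
by have := floor_itv (n.+1%:R * x); rewrite intrD => /andP[-> /ltW]; rewrite lerBlDr andbT.
Qed.

Let floor_gridZ n : exists N : Z, [/\ (0 < N)%BinZ, zr N = n.+1%:R :> R &
  forall t : R, 0 <= t <= 1 -> exists k : Z, (0 <= k <= N)%BinZ /\ floor_grid t n = zr k / n.+1%:R].
Proof.
exists (Z_of_int n.+1); split; [by []|by rewrite /zr Z_of_intK|move=> t /andP[t0 t1]].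
exists (Z_of_int (Num.floor (n.+1%:R * t))); split; last by rewrite /zr Z_of_intK.
have h0 : 0 <= Num.floor (n.+1%:R * t) by rewrite floor_ge0 mulr_ge0.
have h1 : Num.floor (n.+1%:R * t) <= n.+1%:Z.
  by rewrite -(ler_int R) (le_trans (floor_le _))// ler_piMr.
by move: h0 h1; case: (Num.floor _) => // k _; rewrite lez_nat => /ssrnat.leP /=; lia.
Qed.

Let grid_three_point a b c n : 0 <= a <= 1 -> 0 <= b <= 1 -> 0 <= c <= 1 ->
  let x := floor_grid a n in let y := floor_grid b n in let z := floor_grid c n in
  let m := (x + y + z) / 3 in
  takagi m <= 3^-1 * (takagi x + takagi y + takagi z) +
   3^-1 * (`|x - m| + `|y - m| + `|z - m|).
Proof.
move=> a1 b1 c1; have [N [N0 zN grid]] := floor_gridZ n.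
have [x [x1 ->]] := grid _ a1; have [y [y1 ->]] := grid _ b1.
have [z [z1 ->]] := grid _ c1 => /=.
have := @tgrid_three_point R N N0 _ _ _ x1 y1 z1.
have z3 : zr 3 = 3 :> R by [].
have : 0 < n.+1%:R :> R by [].
rewrite /tgrid !zrE zN z3; move: (n.+1%:R) => M M0.
move: (zr x) (zr y) (zr z) => {x1 y1 z1 zN}x' y' z'.
have Mn : M != 0 by rewrite gt_eqF.
have c3 (t : R) : 3 * t / (3 * M) = t / M by field.
rewrite !c3.
have -> : (x' / M + y' / M + z' / M) / 3 = (x' + y' + z') / (3 * M) by field.
have d (t : R) : `|t / M - (x' + y' + z') / (3 * M)| = `|3 * t - (x' + y' + z')| / (3 * M).
  rewrite (_ : _ - _ / _ = (3 * t - (x' + y' + z')) / (3 * M)); last by field.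
  by rewrite normrM [`|(3 * M)^-1|]gtr0_norm// invr_gt0 mulr_gt0.
rewrite !d -!mulrDl.
move: (takagi _) (takagi _) (takagi _) (takagi _) (`|_| + `|_| + `|_|) => s t u v w.
move=> h; rewrite -(@ler_pM2l _ (27 * M)) ?mulr_gt0//.
rewrite (_ : 27 * M * (_ + _) = 9 * M * (u + t + s) + 3 * w); last by field.
lra.
Qed.

(** The rounded triples satisfy the inequality, and both sides converge because [takagi] is
    continuous. *)
Lemma takagi_three_point a b c : 0 <= a <= 1 -> 0 <= b <= 1 -> 0 <= c <= 1 ->
  let m := (a + b + c) / 3 in
  takagi m <= 3^-1 * (takagi a + takagi b + takagi c) +
   3^-1 * (`|a - m| + `|b - m| + `|c - m|).
Proof.
move=> a1 b1 c1; cbv zeta; set m := (a + b + c) / 3; rewrite -subr_ge0.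
have cm : (fun n => (floor_grid a n + floor_grid b n + floor_grid c n) / 3) @ \oo --> m.
  by apply: cvgMl; apply: cvgD; [apply: cvgD|]; exact: floor_grid_cvg.
have ct x (u : nat -> R) : u @ \oo --> x -> (fun n => takagi (u n)) @ \oo --> takagi x.
  by apply: continuous_cvg; exact: continuous_takagi.
have cn x : (fun n => `|floor_grid x n - (floor_grid a n + floor_grid b n + floor_grid c n) / 3|)
    @ \oo --> `|x - m|.
  by apply: cvg_norm; apply: cvgB => //; exact: floor_grid_cvg.
have cs : (fun n => 3^-1 * (takagi (floor_grid a n) + takagi (floor_grid b n) + takagi (floor_grid c n))
   + 3^-1 * (`|floor_grid a n - (floor_grid a n + floor_grid b n + floor_grid c n) / 3|
   + `|floor_grid b n - (floor_grid a n + floor_grid b n + floor_grid c n) / 3|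
   + `|floor_grid c n - (floor_grid a n + floor_grid b n + floor_grid c n) / 3|)
   - takagi ((floor_grid a n + floor_grid b n + floor_grid c n) / 3)) @ \oo -->
  3^-1 * (takagi a + takagi b + takagi c) +
   3^-1 * (`|a - m| + `|b - m| + `|c - m|) - takagi m.
  apply: cvgB; last exact: ct.
  apply: cvgD; apply: cvgMr; do 2?[apply: cvgD] => //; by apply: ct; exact: floor_grid_cvg.
rewrite -(cvg_lim _ cs)//; apply: limr_ge; first by apply/cvg_ex; eexists; exact: cs.
by apply: nearW => n; rewrite subr_ge0; exact: grid_three_point.
Qed.
End ThreePointReal.

(** * The Bellman function and the asymptotics *)

Section Bellman.
Context {R : realType}.
Implicit Types (x : R) (F : R -> R).

Lemma B113_ineq F (a b c : R) : B113_family F ->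
  0 <= a <= 1 -> 0 <= b <= 1 -> 0 <= c <= 1 -> let m := (a + b + c) / 3 in
  F m <= 3^-1 * (F a + F b + F c) + 3^-1 * (`|a - m| + `|b - m| + `|c - m|).
Proof.
move=> [_ _ _ _ FB] a1 b1 c1.
have h (i : 'I_3) : 0 <= [:: a; b; c]`_i <= 1 by case: i => -[|[|[|]]].
by have := FB _ h; rewrite /= !big_ord_recl !big_ord0 /= !addr0 !addrA
  ?big_ord_recl ?big_ord0 /= ?addr0 ?addrA.
Qed.

Lemma takagi_B113 : B113_family (@takagi R).
Proof.
split; [exact/continuous_subspaceT/continuous_takagi|by move=> *; exact: takagi_ge0
 |exact: takagi0|exact: takagi1|].
move=> x x01; rewrite /= !big_ord_recl !big_ord0 /= !addr0 !addrA
  ?big_ord_recl ?big_ord0 /= ?addr0 ?addrA.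
exact: takagi_three_point.
Qed.

Lemma B113_le_takagi F x : B113_family F -> 0 <= x <= 1 -> F x <= takagi x.
Proof.
move=> FB x01; have [Fc F0 FF0 FF1 _] := FB.
have [y _ Fy] := EVT_max ler01 Fc.
rewrite -subr_ge0; pose P x := (0 <= x <= 1 : Prop).
(* [F y] is the maximum of [F] on the unit interval and [takagi] is nonnegative, which bounds the
   difference from below. *)
apply: (@contraction_ge0 _ _ P (fun x => takagi x - F x) (F y)) => // {x x01} x x01.
  have := Fy x; rewrite in_itv/= => /(_ x01); have := takagi_ge0 x; lra.
have [x0 x1] := andP x01.
have ineq a b c : a + b + c = 3 * x -> 0 <= a <= 1 -> 0 <= b <= 1 -> 0 <= c <= 1 ->
   F x <= 3^-1 * (F a + F b + F c) + 3^-1 * (`|a - x| + `|b - x| + `|c - x|).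
  move=> e a1 b1 c1; have := B113_ineq _ _ _ _ FB a1 b1 c1.
  by rewrite /= e (_ : 3 * x / 3 = x)//; field.
(* One triple for each third; two of its entries are 0 or 1, where [F] vanishes, so only the value
   of [F] at the ternary remainder survives. *)
right; have [h|h] := lerP x 3^-1.
  have y01 : 0 <= 3 * x <= 1 by apply/andP; split; lra.
  exists (3 * x) => //; rewrite (takagi_digit 0 x) // mulr0z subr0 psi3_lower ?x0//.
  have := ineq (3 * x) 0 0; rewrite !addr0 !lexx !ler01 => /(_ erefl y01 isT isT).
  have -> : `|3 * x - x| = 2 * x by rewrite ger0_norm; lra.
  have -> : `|0 - x| = x by rewrite ler0_norm; lra.
  by rewrite FF0; lra.
have [h'|h'] := lerP x (2 / 3).
  have y01 : 0 <= 3 * x - 1 <= 1 by apply/andP; split; lra.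
  exists (3 * x - 1) => //; rewrite (takagi_digit 1 x) // psi3_middle ?h' ?(ltW h)//.
  have := ineq 1 (3 * x - 1) 0; rewrite !lexx !ler01 => /(_ _ isT y01 isT).
  have -> : `|1 - x| = 1 - x by rewrite ger0_norm; lra.
  have -> : `|0 - x| = x by rewrite ler0_norm; lra.
  have -> : `|3 * x - 1 - x| = 2 * `|x - 2^-1|.
    by rewrite (_ : _ - x = 2 * (x - 2^-1)) ?normrM ?[`|2|]ger0_norm//; field.
  rewrite FF0 FF1 => /(_ ltac:(ring)).
  by rewrite mulr1z; lra.
have y01 : 0 <= 3 * x - 2 <= 1 by apply/andP; split; lra.
exists (3 * x - 2) => //; rewrite (takagi_digit 2 x) // psi3_upper ?x1 ?(ltW h')//.
have := ineq 1 1 (3 * x - 2); rewrite !lexx !ler01 => /(_ _ isT isT y01).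
have -> : `|1 - x| = 1 - x by rewrite ger0_norm; lra.
have -> : `|3 * x - 2 - x| = 2 - 2 * x by rewrite ler0_norm; lra.
by rewrite FF1 => /(_ ltac:(ring)); rewrite (_ : 2%:~R = 2 :> R)//; lra.
Qed.

Lemma B113_takagi x : 0 <= x <= 1 -> B113 x = T3 x.
Proof.
move=> x01; rewrite T3E; apply/eqP; rewrite eq_le; apply/andP; split.
  by apply: ub_ereal_sup => _ [F FB <-]; rewrite lee_fin B113_le_takagi.
by apply: ereal_sup_ubound; exists takagi => //; exact: takagi_B113.
Qed.

(** * Comparison of [T3] with [x log (1/x)] *)

Lemma entropy_rec x : 0 < x -> x * ln (1 / x) = x * ln 3 + 3 * x * ln (1 / (3 * x)) / 3.
Proof.
move=> x0; have x3 : 0 < 3 * x by rewrite mulr_gt0.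
by rewrite !div1r !lnV ?posrE// lnM ?posrE//; field.
Qed.

Lemma takagi_entropy : exists c C : R, [/\ 0 < c, c <= C &
  forall x : R, 0 < x <= 2^-1 ->
    c * (x * ln (1 / x)) <= takagi x /\ takagi x <= C * (x * ln (1 / x))].
Proof.
have ln1 (x : R) : 0 < x -> ln x <= x - 1.
  move=> x0; have e : 1 + (x - 1) = x by ring.
  by have := @le_ln1Dx R (x - 1); rewrite e; apply; lra.
have ln2 : 2^-1 <= ln 2 :> R.
  have := ln1 2^-1 ltac:(by rewrite invr_gt0); rewrite lnV ?posrE//; lra.
have ln23 : ln 2 <= ln 3 :> R by rewrite ler_ln ?posrE//; lra.
have ln3 := ln1 3 ltac:(by []); have ln6 := ln1 6 ltac:(by []).
have hb (x : R) : 0 < x <= 2^-1 -> 0 <= x * ln (1 / x) <= 1.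
  move=> /andP[x0 x1]; rewrite div1r lnV ?posrE//.
  have h := ln1 _ x0.
  have := ln1 x^-1 ltac:(by rewrite invr_gt0); rewrite lnV ?posrE// => h2.
  have : x * x^-1 = 1 by rewrite divff ?gt_eqF.
  by move: x^-1 h2 => y h2 xy; apply/andP; split; nra.
have hs (x : R) : 6^-1 <= x <= 2^-1 -> ln 2 <= ln (1 / x) <= ln 6.
  move=> /andP[x0 x1]; have x2 : 0 < x by lra.
  by rewrite div1r !ler_ln ?posrE ?invr_gt0// -[2]invrK -[6]invrK !lef_pV2 ?posrE ?invr_gt0// x0 x1.
pose P (x : R) : Prop := 0 < x <= 2^-1.
have psi_lb (x : R) : 6^-1 <= x <= 2^-1 -> 2 / 9 <= psi3 x.
  move=> /andP[x0 x1]; have [h|h] := leP x 3^-1.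
    by rewrite psi3_lower; [lra|apply/andP; split; lra].
  rewrite psi3_middle; last by apply/andP; split; lra.
  have := normr_ge0 (x - 2^-1); lra.
have rec (x : R) : 0 < x < 6^-1 -> takagi x = 4 / 3 * x + takagi (3 * x) / 3.
  move=> /andP[x0 x1]; rewrite (takagi_digit 0 x) ?psi3_lower ?mulr0z ?subr0//;
  by apply/andP; split; lra.
(* Below [1/6] the point [3x] stays in the range and the recursions are compared through
   [c ln 3 <= 4/3 <= C ln 3]. On [[1/6, 1/2]] one has [2/9 <= T3 <= 2/3], while [x ln (1/x)] lies
   between [1/6 * 1/2] and [1/2 * 5] because [1/2 <= ln 2] and [ln 6 <= 5]; the quotients are [4/45]
   and [8]. *)
exists (4 / 45), (8 : R); split=> [||x x01]; [lra|lra|].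
split; rewrite -subr_ge0.
  apply: (@contraction_ge0 _ _ P (fun x => takagi x - 4 / 45 * (x * ln (1 / x))) 1) => // {x x01} x x01.
    by have /andP[_] := hb x x01; have := takagi_ge0 x; lra.
  have /andP[x0 x1] := x01; have [h|h] := leP 6^-1 x.
    have x2 : 6^-1 <= x <= 2^-1 by rewrite h.
    left; have /andP[_ l6] := hs _ x2; have := psi_lb _ x2.
    rewrite (takagi_digit 0 x); last by apply/andP; split; lra.
    have := takagi_ge0 (3 * x - 0%:~R).
    by move: (takagi _) (ln (1 / x)) (psi3 x) l6 => t l p l6; nra.
  right; exists (3 * x); first by apply/andP; split; lra.
  rewrite (rec x) ?x0// (entropy_rec x)//.
  by move: (takagi (3 * x)) (ln (1 / (3 * x))) => t l; nra.
apply: (@contraction_ge0 _ _ P (fun x => 8 * (x * ln (1 / x)) - takagi x) 1) => // {x x01} x x01.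
  by have /andP[+ _] := hb x x01; have := takagi_le x; lra.
have /andP[x0 x1] := x01; have [h|h] := leP 6^-1 x.
  have x2 : 6^-1 <= x <= 2^-1 by rewrite h.
  left; have /andP[l2 _] := hs _ x2; have := takagi_le x.
  by move: (takagi _) (ln (1 / x)) l2 => t l l2; nra.
right; exists (3 * x); first by apply/andP; split; lra.
rewrite (rec x) ?x0// (entropy_rec x)//.
by move: (takagi (3 * x)) (ln (1 / (3 * x))) => t l; nra.
Qed.
End Bellman.

(** * Conditional expectation on a finite partition *)

Section FinitePartition.
Context {d : measure_display} {T : measurableType d} {R : realType}.
Variables (mu : {measure set T -> \bar R}) (D : set T) (n : nat).
Variables (C : nat -> set T) (idx : T -> nat) (p : R).
Hypothesis p0 : 0 < p.
Hypothesis mC : forall k, measurable (C k).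
Hypothesis muC : forall k, (k < n)%N -> mu (C k) = p%:E.
Hypothesis idxP : forall x, D x -> (idx x < n)%N /\ C (idx x) x.
Hypothesis CP : forall k x, (k < n)%N -> C k x -> D x /\ idx x = k.

Local Notation G := [set I | exists2 k, (k < n)%N & I = C k].

Lemma trivIset_cells (s : seq nat) : (forall k, k \in s -> (k < n)%N) -> trivIset [set` s] C.
Proof.
move=> sn i j /= /sn ni /sn nj [x [Ci Cj]].
by have [_ <-] := CP _ _ ni Ci; have [_ <-] := CP _ _ nj Cj.
Qed.

Lemma step_preimage (U : Type) (h : nat -> U) (Y : set U) :
  D `&` (h \o idx) @^-1` Y = \bigcup_(k in [set k | (k < n)%N /\ Y (h k)]) C k.
Proof.
apply/seteqP; split=> [x [Dx Yx]|x [k [kn Yk] Ck]].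
  by have [? ?] := idxP _ Dx; exists (idx x).
by have [Dx e] := CP _ _ kn Ck; split=> //=; rewrite e.
Qed.

Lemma cellsD : D = \bigcup_(k in [set k | (k < n)%N]) C k.
Proof.
have := step_preimage unit (fun=> tt) setT; rewrite preimage_setT setIT => ->.
by apply: eq_bigcupl; split=> k /=; [case|].
Qed.

Lemma measurable_cellsU (P : set nat) : measurable (\bigcup_(k in P) C k).
Proof. exact: bigcup_measurable. Qed.

Lemma measurable_cells : measurable D.
Proof. by rewrite cellsD; exact: measurable_cellsU. Qed.

Lemma sigma_cellsU (P : set nat) : P `<=` [set k | (k < n)%N] ->
  <<s D, G>> (\bigcup_(k in P) C k).
Proof.
move=> Pn; have [s0 _ sU] := @smallest_sigma_algebra _ D G.
rewrite bigcup_mkcond; apply: sU => k; case: ifPn => //.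
by rewrite inE => /Pn kn; apply: sub_sigma_algebra; exists k.
Qed.

Lemma measurable_step (h : nat -> R) : measurable_fun D (h \o idx).
Proof. by move=> _ Y mY; rewrite step_preimage; exact: measurable_cellsU. Qed.

(** The subsets of [D] that contain or miss each cell form a sigma-algebra on [D] to which the cells
    belong. *)
Lemma sigma_saturated N : <<s D, G>> N ->
  N `<=` D /\ forall k, (k < n)%N -> C k `<=` N \/ C k `&` N = set0.
Proof.
apply: (@smallest_sub _ _ _ [set N | N `<=` D /\ forall k, (k < n)%N -> C k `<=` N \/ C k `&` N = set0]).
  split=> /=.
  - by split=> [//|k _]; right; rewrite setI0.
  - move=> M [MD Mk]; split=> [x []//|k kn]; have [CM|CM] := Mk k kn.
      by right; apply/seteqP; split=> // x [/CM Mx [_ /(_ Mx)]].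
    left=> x Cx; split; first by have [] := CP _ _ kn Cx.
    by move=> Mx; have : (C k `&` M) x by []; rewrite CM.
  - move=> M MD; split=> [x [i _ Mx]|k kn]; first by have [+ _] := MD i; exact.
    have [[i CM]|nC] := pselect (exists i, C k `<=` M i).
      by left=> x /CM ?; exists i.
    right; apply/seteqP; split=> // x [Cx [i _ Mx]].
    have [_ /(_ k kn)[CM|CM]] := MD i; first by apply: nC; exists i.
    by have : (C k `&` M i) x by []; rewrite CM.
move=> _ [k kn ->]; split=> [x Ck|j jn]; first by have [] := CP _ _ kn Ck.
have [->|jk] := eqVneq j k; first by left.
right; apply/seteqP; split=> // x [Cj Ck]; move/eqP: jk; apply.
by have [_ <-] := CP _ _ jn Cj; have [_ <-] := CP _ _ kn Ck.
Qed.

Lemma integral_saturated N (f : T -> \bar R) : <<s D, G>> N ->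
  measurable_fun D f -> (forall x, D x -> 0 <= f x)%E ->
  (\int[mu]_(x in N) f x = \sum_(k <- iota 0 n | `[< C k `<=` N >]) \int[mu]_(x in C k) f x)%E.
Proof.
move=> sN mf f0; have [ND sat] := sigma_saturated _ sN.
have NE : N = \big[setU/set0]_(k <- [seq k <- iota 0 n | `[< C k `<=` N >]]) C k.
  rewrite -bigcup_seq; apply/seteqP; split=> [x Nx|x [k /= + Ck]]; last first.
    by rewrite mem_filter => /andP[/asboolP CN _]; exact: CN.
  have [kn Cx] := idxP _ (ND _ Nx); exists (idx x) => //=.
  rewrite mem_filter mem_iota leq0n add0n kn !andbT; apply/asboolP.
  have [CN|CN] := sat _ kn; first exact: CN.
  by have : (C (idx x) `&` N) x by []; rewrite CN.
rewrite -[RHS]big_filter {1}NE; apply: ge0_integral_bigsetU => //.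
- by rewrite filter_uniq ?iota_uniq.
- by apply: trivIset_cells => k; rewrite mem_filter mem_iota => /andP[].
- by rewrite -NE; apply: measurable_funS mf => //; exact: measurable_cells.
- by rewrite -NE => x /ND /f0.
Qed.

Lemma integral_cell (h : nat -> R) k : (k < n)%N ->
  (\int[mu]_(x in C k) (h (idx x))%:E = (h k * p)%:E)%E.
Proof.
move=> kn; rewrite EFinM -(muC _ kn) -integral_cst//.
by apply: eq_integral => x; rewrite inE => Cx; have [_ ->] := CP _ _ kn Cx.
Qed.

Lemma sigma_cells : <<s D, G>> D.
Proof. by rewrite [X in <<s D, _ >> X]cellsD; exact: sigma_cellsU. Qed.

Lemma integral_step (h : nat -> R) : (forall k, 0 <= h k) ->
  (\int[mu]_(x in D) (h (idx x))%:E = (\sum_(k < n) h k * p)%:E)%E.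
Proof.
move=> h0; rewrite (integral_saturated _ _ sigma_cells).
- rewrite -sumEFin -(big_mkord xpredT (fun k => (h k * p)%:E)) /index_iota subn0.
  rewrite big_seq_cond [RHS]big_seq; apply: eq_big => [k|k].
    rewrite mem_iota /= add0n; case: ltnP => //= kn.
    by apply/asboolP => x Ck; have [] := CP _ _ kn Ck.
  by rewrite mem_iota => /andP[/andP[_ kn] _]; rewrite integral_cell.
- by apply/measurable_EFinP; exact: measurable_step.
- by move=> x _; rewrite lee_fin.
Qed.

(** The cell averages form a version, so [xget] does return one. Any version [g] is constant on the
    cell of [x], because the level set of [g] through [x] is saturated; integrating over this cell,
    of measure [p > 0], determines the constant. *)
Lemma condexp_indic A : measurable A -> forall x, D x ->
  condexp mu D <<s D, G>> \1_A x = fine (mu (A `&` C (idx x))) / p.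
Proof.
move=> mA; pose h k := fine (mu (A `&` C k)) / p.
have le1 k : (k < n)%N -> (mu (A `&` C k) <= p%:E)%E.
  by move=> kn; rewrite -(muC _ kn) le_measure ?inE//; exact: measurableI.
have fin k : (k < n)%N -> mu (A `&` C k) \is a fin_num.
  by move=> /le1 h1; rewrite ge0_fin_numE// (le_lt_trans h1) ?ltry.
have hp k : (k < n)%N -> (h k * p)%:E = mu (A `&` C k).
  by move=> kn; rewrite /h divfK ?gt_eqF// fineK// fin.
have mf : measurable_fun D (fun x => (\1_A x)%:E : \bar R).
  by apply/measurable_EFinP; exact: measurable_indic.
have icell k : (k < n)%N -> (\int[mu]_(x in C k) (\1_A x)%:E = (h k * p)%:E)%E.
  by move=> kn; rewrite integral_indic// hp.
have ex : is_condexp mu D <<s D, G>> \1_A (fun x => h (idx x)).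
  split=> [Y _||N sN].
  - by rewrite (step_preimage _ h); apply: sigma_cellsU => k [].
  - apply/integrableP; split; first by apply/measurable_EFinP; exact: measurable_step.
    by rewrite (integral_step (fun k => `|h k|)) ?ltry.
  - rewrite !integral_saturated//.
    + rewrite big_seq_cond [RHS]big_seq_cond; apply: eq_bigr => k.
      by rewrite mem_iota => /andP[/andP[_ kn] _]; rewrite integral_cell// icell.
    + by apply/measurable_EFinP; exact: measurable_step.
    + by move=> x _; rewrite lee_fin divr_ge0 ?(ltW p0) ?fine_ge0.
have [inv int eqi] := @xgetPex _ (cst 0) _ (ex_intro _ _ ex).
move=> x Dx; have [kn Cx] := idxP _ Dx.
set g := condexp _ _ _ _; set k := idx x in kn Cx *.
have sg : <<s D, G>> (D `&` g @^-1` [set g x]) by exact: inv.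
have [_ /(_ k kn)[Cg|Cg]] := sigma_saturated _ sg; last first.
  by exfalso; have : (C k `&` (D `&` g @^-1` [set g x])) x by []; rewrite Cg.
have : (\int[mu]_(x in C k) (g x)%:E = (h k * p)%:E)%E.
  by rewrite -icell//; apply: eqi; apply: sub_sigma_algebra; exists k.
rewrite (_ : \int[mu]_(y in _) _ = (g x * p)%:E)%E.
  by move=> [/(mulIf _)->//]; rewrite gt_eqF.
rewrite EFinM -(muC _ kn) -integral_cst//.
by apply: eq_integral => y; rewrite inE => /Cg[_ /= ->].
Qed.

End FinitePartition.

(** * The triadic martingale of an indicator *)

Section TriadicCells.
Context {R : realType}.
Implicit Types (x : R) (m k : nat) (A : set R).
Local Notation leb := (@completed_lebesgue_measure R).

Definition cell m k : set R := `[k%:R / 3 ^+ m, k.+1%:R / 3 ^+ m[.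
(** Truncation sends negative numbers to 0, hence the hypothesis [0 <= x] in the lemmas on [idx]. *)
Definition idx m x : nat := Num.truncn (3 ^+ m * x).

Lemma exp3_gt0 m : 0 < 3 ^+ m :> R. Proof. by rewrite exprn_gt0. Qed.
Hint Resolve exp3_gt0 : core.

Lemma cellE m k x : cell m k x = (k%:R <= 3 ^+ m * x < k.+1%:R) :> Prop.
Proof. by rewrite /cell /= in_itv/= ler_pdivrMr// ltr_pdivlMr// mulrC. Qed.

Lemma idxP m x k : 0 <= x -> cell m k x <-> idx m x = k.
Proof.
move=> x0; rewrite cellE -truncn_eq ?mulr_ge0//; split=> [/eqP //|<-].
by apply/eqP.
Qed.

Lemma cell_ge0 m k x : cell m k x -> 0 <= x.
Proof.
by rewrite cellE => /andP[kx _]; rewrite -(pmulr_rge0 _ (exp3_gt0 m)) (le_trans _ kx).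
Qed.

Lemma cell_idx m k x : cell m k x -> idx m x = k.
Proof. by move=> c; apply/idxP => //; exact: cell_ge0 c. Qed.

Lemma idx_cell m x : 0 <= x -> cell m (idx m x) x.
Proof. by move=> x0; apply/idxP. Qed.

Lemma cell_unit m k x : (k < 3 ^ m)%N -> cell m k x -> @unit_itv R x.
Proof.
move=> km c; rewrite /unit_itv /= in_itv/= (cell_ge0 _ _ _ c)/=.
move: c; rewrite cellE => /andP[_ kx]; rewrite -(ltr_pM2l (exp3_gt0 m)) mulr1.
by apply: lt_le_trans kx _; rewrite -natrX ler_nat.
Qed.

Lemma unit_idx m x : @unit_itv R x -> (idx m x < 3 ^ m)%N /\ cell m (idx m x) x.
Proof.
rewrite /unit_itv /= in_itv/= => /andP[x0 x1]; have c := idx_cell m _ x0; split=> //.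
move: c; rewrite cellE => /andP[+ _]; rewrite -(ltr_nat R) natrX.
by move=> /le_lt_trans; apply; rewrite gtr_pMr.
Qed.

Lemma cell_unit_idx m k x : (k < 3 ^ m)%N -> cell m k x -> @unit_itv R x /\ idx m x = k.
Proof. by move=> km c; split; [exact: cell_unit km c|exact: cell_idx]. Qed.

Lemma measurable_cell m k : lebesgue_measurable (cell m k).
Proof. by apply: sub_caratheodory; exact: measurable_itv. Qed.

Lemma leb_cell m k : leb (cell m k) = (3 ^- m)%:E.
Proof.
(* The completed and the Borel measure come from the same outer measure and agree on a cell. *)
transitivity (@lebesgue_measure R (cell m k)) => //.
rewrite lebesgue_measure_itv/= lte_fin ltr_pM2r ?invr_gt0// ltr_nat leqnn.
by rewrite -EFinB -mulrBl -natrB// subSnn mul1r.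
Qed.

Lemma unit_cell0 : @unit_itv R = cell 0 0.
Proof. by rewrite /cell expr0 mul0r divr1. Qed.

Lemma idx_parent m x : 0 <= x -> idx m x = (idx m.+1 x %/ 3)%N.
Proof.
move=> x0; apply: truncn_def; have := idx_cell m.+1 _ x0; rewrite cellE exprS -mulrA.
set i := idx m.+1 x; have e : i%:R = 3 * (i %/ 3)%:R + (i %% 3)%:R :> R.
  by rewrite -natrM mulnC -natrD -divn_eq.
have r3 : (i %% 3)%:R <= 2 :> R by rewrite ler_nat -ltnS ltn_pmod.
have r0 : 0 <= (i %% 3)%:R :> R by [].
rewrite -(natr1 i) -(natr1 (i %/ 3)%N) e => /andP[h1 h2]; apply/andP; split; lra.
Qed.

(** * The martingale of an indicator as densities in cells *)

Section Density.
Variable A : set R.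
Hypothesis mA : lebesgue_measurable A.

Definition density m k : R := fine (leb (A `&` cell m k)) / 3 ^- m.

Lemma measurable_cellI m k : lebesgue_measurable (A `&` cell m k).
Proof. by apply: measurableI => //; exact: measurable_cell. Qed.

Lemma leb_cellI m k : leb (A `&` cell m k) = (density m k / 3 ^+ m)%:E.
Proof.
rewrite /density divfK ?invr_neq0 ?gt_eqF// fineK// ge0_fin_numE//.
apply: le_lt_trans (_ : leb (cell m k) < +oo)%E; last by rewrite leb_cell ltry.
by apply: le_measure; rewrite ?inE//; [exact: measurable_cellI|exact: measurable_cell].
Qed.

Lemma density_ge0 m k : 0 <= density m k.
Proof. by rewrite /density divr_ge0 ?fine_ge0// invr_ge0 ltW. Qed.

Lemma density_le1 m k : density m k <= 1.
Proof.
have : (leb (A `&` cell m k) <= leb (cell m k))%E.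
  by apply: le_measure; rewrite ?inE//; [exact: measurable_cellI|exact: measurable_cell].
by rewrite leb_cellI leb_cell lee_fin ler_pdivrMr// mulVf// gt_eqF.
Qed.

Lemma mart_density m x : @unit_itv R x -> mart \1_A m x = density m (idx m x).
Proof.
move=> ux; have p0 : 0 < 3 ^- m :> R by rewrite invr_gt0.
exact: (condexp_indic leb (@unit_itv R) (3 ^ m)%N (cell m) (idx m) _ p0 (measurable_cell m)
  (fun k _ => leb_cell m k) (unit_idx m) (cell_unit_idx m) A mA x ux).
Qed.

(* The integral of [|d_(m+1)|]; the parent of the cell [k] is the cell [k %/ 3]. *)
Definition variation m : R :=
  \sum_(k < 3 ^ m.+1) `|density m.+1 k - density m (k %/ 3)| * 3 ^- m.+1.

Lemma variation_ge0 m : 0 <= variation m.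
Proof. by apply: sumr_ge0 => k _; rewrite mulr_ge0// invr_ge0 ltW. Qed.

(** Monotone convergence exchanges sum and integral, and each difference is a step function on the
    cells of its level. The index is shifted by one, since differences start at level 1. *)
Lemma norm1_S1 : norm1 (S1 \1_A) = (\sum_(0 <= m <oo) (variation m)%:E)%E.
Proof.
have mD m x : @unit_itv R x -> mart_diff \1_A m.+1 x =
    density m.+1 (idx m.+1 x) - density m (idx m.+1 x %/ 3)%N.
  move=> ux; rewrite /mart_diff !mart_density//= (idx_parent m)//.
  by move: ux; rewrite /unit_itv/= in_itv/= => /andP[].
pose h m k : R := `|density m.+1 k - density m (k %/ 3)|.
transitivity (\int[leb]_(x in @unit_itv R) \sum_(0 <= m <oo) (h m (idx m.+1 x))%:E)%E.
  apply: eq_integral => x; rewrite inE => ux; rewrite gee0_abs.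
    rewrite /S1 -(nneseries_addn 1)//.
    by apply: eq_eseriesr => m _; rewrite addn1 mD.
  by apply: nneseries_ge0 => *; rewrite lee_fin.
rewrite integral_nneseries.
- apply: eq_eseriesr => m _; have p0 : 0 < 3 ^- m.+1 :> R by rewrite invr_gt0.
  exact: (integral_step leb (@unit_itv R) (3 ^ m.+1)%N (cell m.+1) (idx m.+1) _
    (measurable_cell m.+1) (fun k _ => leb_cell m.+1 k) (unit_idx m.+1) (cell_unit_idx m.+1)
    (h m) (fun k => normr_ge0 _)).
- by rewrite unit_cell0; exact: measurable_cell.
- move=> m; apply/measurable_EFinP.
  exact: (@measurable_step _ (caratheodory_type ((wlength (@idfun R))^*)%mu) R
    (@unit_itv R) (3 ^ m.+1)%N (cell m.+1) (idx m.+1)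
    (measurable_cell m.+1) (unit_idx m.+1) (cell_unit_idx m.+1) (h m)).
- by move=> m x _; rewrite lee_fin; exact: normr_ge0.
Qed.

Lemma cell_split m k : cell m k = cell m.+1 (3 * k) `|` cell m.+1 (3 * k + 1) `|` cell m.+1 (3 * k + 2).
Proof.
apply/seteqP; split=> [x c|x c].
  have x0 := cell_ge0 _ _ _ c; have := idx_parent m _ x0; rewrite (cell_idx _ _ _ c).
  have := idx_cell m.+1 _ x0; set q := idx _ _ => cq kq.
  have := ltn_pmod q (isT : 0 < 3)%N; have := divn_eq q 3; rewrite -kq mulnC.
  case: (q %% 3)%N => [|[|[|]]]// qe _; rewrite qe ?addn0 in cq.
  - by left; left.
  - by left; right.
  - by right.
have x0 : 0 <= x by case: c => [[]|] /cell_ge0.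
apply/(idxP m _ k) => //; rewrite (idx_parent m)//.
by case: c => [[]|] /cell_idx ->; rewrite ?mulKn// mulnC divnMDl// addn0.
Qed.

(** The martingale property; it presents the parent density as the mean required by the three-point
    inequality. *)
Lemma density_split m k :
  density m k = (density m.+1 (3 * k) + density m.+1 (3 * k + 1) + density m.+1 (3 * k + 2)) / 3.
Proof.
have dis i j : i <> j -> (A `&` cell m.+1 i) `&` (A `&` cell m.+1 j) = set0.
  move=> ij; apply/seteqP; split=> // x [[_ /cell_idx ci] [_ /cell_idx cj]].
  by apply: ij; rewrite -ci -cj.
have U (X Y : set R) : lebesgue_measurable X -> lebesgue_measurable Y -> X `&` Y = set0 ->
    leb (X `|` Y) = (leb X + leb Y)%E by exact: measureU.
have mI := measurable_cellI m.+1.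
have d1 : (A `&` cell m.+1 (3 * k)) `&` (A `&` cell m.+1 (3 * k + 1)) = set0 by apply: dis; lia.
have d2 : (A `&` cell m.+1 (3 * k) `|` A `&` cell m.+1 (3 * k + 1)) `&`
    (A `&` cell m.+1 (3 * k + 2)) = set0 by rewrite setIUl !dis ?setU0//; lia.
have := leb_cellI m k; rewrite cell_split !setIUr.
rewrite (U _ _ (measurableU _ _ (mI _) (mI _)) (mI _) d2) (U _ _ (mI _) (mI _) d1).
rewrite !leb_cellI -!EFinD => -[] e.
apply: (mulIf (_ : 3 ^- m != 0)); first by rewrite invr_neq0// gt_eqF.
by rewrite -e exprS; field; rewrite gt_eqF.
Qed.

End Density.
End TriadicCells.

(** * Lower bound for the variation *)

Section VariationBounds.
Context {R : realType}.
Implicit Types (x e : R) (m k : nat) (A B W X Y F U : set R).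
Local Notation leb := (@completed_lebesgue_measure R).

Lemma sum_triples n (F : nat -> R) :
  \sum_(j < 3 * n) F j = \sum_(k < n) (F (3 * k)%N + F (3 * k + 1)%N + F (3 * k + 2)%N).
Proof.
elim: n => [|n IH]; first by rewrite muln0 !big_ord0.
rewrite [RHS]big_ord_recr /= -IH (_ : 3 * n.+1 = (3 * n).+3)%N; last by rewrite mulnS addnC addn3.
by rewrite !big_ord_recr /= addn1 addn2 !addrA.
Qed.

Lemma variationE A m : variation A m = \sum_(k < 3 ^ m)
  (`|density A m.+1 (3 * k) - density A m k| + `|density A m.+1 (3 * k + 1) - density A m k|
   + `|density A m.+1 (3 * k + 2) - density A m k|) * 3 ^- m.+1.
Proof.
rewrite /variation expnS (sum_triples _
  (fun k => `|density A m.+1 k - density A m (k %/ 3)| * 3 ^- m.+1)).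
apply: eq_bigr => k _; rewrite -!mulrDl mulKn//.
by rewrite [(3 * k)%N]mulnC !divnMDl// !addn0.
Qed.

Lemma sum_density A m : lebesgue_measurable A ->
  \sum_(k < 3 ^ m) density A m k * 3 ^- m = density A 0 0.
Proof.
move=> mA; elim: m => [|m <-].
  by rewrite expn0 big_ord_recl big_ord0 expr0 invr1 mulr1 addr0.
rewrite expnS (sum_triples _ (fun k => density A m.+1 k * 3 ^- m.+1)).
apply: eq_bigr => k _; rewrite (density_split _ mA m) exprS invfM.
by move: (3 ^- m) => q; field.
Qed.

(** The integral of [takagi] composed with the martingale at time [m]. *)
Definition potential A m : R := \sum_(k < 3 ^ m) takagi (density A m k) * 3 ^- m.

Lemma density01 A m k : lebesgue_measurable A -> 0 <= density A m k <= 1.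
Proof. by move=> mA; rewrite density_ge0 density_le1. Qed.

(** The three-point inequality in each cell, applied to the densities of its three children and
    weighted by the measure of the cell. *)
Lemma potential_step A m : lebesgue_measurable A ->
  potential A m <= potential A m.+1 + variation A m.
Proof.
move=> mA; rewrite variationE /potential expnS.
rewrite (sum_triples _ (fun k => takagi (density A m.+1 k) * 3 ^- m.+1)).
rewrite -big_split; apply: ler_sum => k _ /=; rewrite (density_split _ mA m).
have := takagi_three_point _ _ _ (density01 A m.+1 (3 * k) mA)
  (density01 A m.+1 (3 * k + 1) mA) (density01 A m.+1 (3 * k + 2) mA).
rewrite /= exprS invfM; set M := (_ / 3).
have : 0 < 3 ^- m :> R by rewrite invr_gt0 exprn_gt0.
move: (3 ^- m) (takagi M) => q t q0.
move: `|_| `|_| `|_| => u v w; move: (takagi _) (takagi _) (takagi _) => a b c h.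
have := ler_wpM2r (ltW q0) h; lra.
Qed.

Lemma potential_le A m : lebesgue_measurable A ->
  potential A 0 <= potential A m + \sum_(0 <= i < m) variation A i.
Proof.
move=> mA; elim: m => [|m IH]; first by rewrite big_geq// addr0.
by rewrite big_nat_recr//=; have := potential_step A m mA; lra.
Qed.

Lemma leb_density00 A : A `<=` @unit_itv R -> lebesgue_measurable A ->
  leb A = (density A 0 0)%:E.
Proof.
move=> AU mA; rewrite -[in LHS](setIidl AU) unit_cell0 leb_cellI//.
by rewrite expr0 divr1.
Qed.

Lemma density00_le A : lebesgue_measurable A -> ((density A 0 0)%:E <= leb A)%E.
Proof.
move=> mA; have := leb_cellI A mA 0 0; rewrite expr0 divr1 => <-.
by apply: le_measure; rewrite ?inE//; exact: measurable_cellI.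
Qed.

(** * Approximation of measurable sets by unions of triadic cells *)

Lemma density_sub W X Y m k : lebesgue_measurable W -> lebesgue_measurable X ->
  lebesgue_measurable Y -> W `&` cell m k `<=` X `|` Y ->
  density W m k <= density X m k + density Y m k.
Proof.
move=> mW mX mY sub.
have : (leb (W `&` cell m k) <= leb (X `&` cell m k) + leb (Y `&` cell m k))%E.
  apply: le_trans (_ : leb ((X `&` cell m k) `|` (Y `&` cell m k)) <= _)%E.
    apply: le_measure; rewrite ?inE.
    - exact: measurable_cellI.
    - by apply: measurableU; exact: measurable_cellI.
    - by rewrite -setIUl => x [Wx cx]; split=> //; exact: sub.
  exact: (measureU2 leb (measurable_cellI X mX m k) (measurable_cellI Y mY m k)).
by rewrite !leb_cellI// -EFinD lee_fin -mulrDl ler_pM2r// invr_gt0 exprn_gt0.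
Qed.

Lemma density_setT m k : density setT m k = 1 :> R.
Proof. by rewrite /density setTI leb_cell/= divff// invr_neq0// expf_neq0. Qed.

Lemma borel_lebesgue A : @measurable _ (measurableTypeR R) A -> lebesgue_measurable A.
Proof. exact: sub_caratheodory. Qed.

Lemma cell_subset m x : 0 <= x -> @cell R m.+1 (idx m.+1 x) `<=` cell m (idx m x).
Proof.
move=> x0 y c; have y0 := cell_ge0 _ _ _ c.
by apply/(idxP m) => //; rewrite (idx_parent m)// (cell_idx _ _ _ c) -idx_parent.
Qed.

Lemma cell_dist m k x y : cell m k x -> cell m k y -> `|x - y| < 3 ^- m.
Proof.
rewrite !cellE => /andP[x0 x1] /andP[y0 y1].
rewrite -(ltr_pM2l (exp3_gt0 m)) mulfV ?gt_eqF ?exprn_gt0//.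
rewrite -[X in X * _](@gtr0_norm R (3 ^+ m)) ?exprn_gt0// -normrM mulrBr ltr_norml.
by move: x1 y1; rewrite -(natr1 k) => *; apply/andP; split; lra.
Qed.

(** The uncovered parts of [F] decrease with [m], since a cell lies in its parent, and have empty
    intersection, since a small enough cell around a point of the open set [U] lies in [U].
    Continuity from above applies because [F] has finite measure. *)
Lemma inner_cells_cvg (U F : set R) e : open U -> F `<=` U -> F `<=` @unit_itv R ->
  @measurable _ (measurableTypeR R) F -> 0 < e ->
  exists m, (@lebesgue_measure R
    (F `\` \bigcup_(k in [set k | (cell m k : set R) `<=` U]) cell m k) < e%:E)%E.
Proof.
move=> oU FU Fu mF e0.
pose B m : set R := \bigcup_(k in [set k | (cell m k : set R) `<=` U]) cell m k.
have mB m : @measurable _ (measurableTypeR R) (B m).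
  by apply: bigcup_measurable => k _; exact: measurable_itv.
have mFB m : @measurable _ (measurableTypeR R) (F `\` B m) by exact: measurableD.
have F1 : (lebesgue_measure F <= 1)%E.
  apply: le_trans (_ : lebesgue_measure (@unit_itv R) <= 1)%E.
    by apply: le_measure; rewrite ?inE//; exact: measurable_itv.
  by rewrite lebesgue_measure_itv/= lte_fin ltr01 -EFinB subr0.
have cap0 : \bigcap_m (F `\` B m) = set0.
  apply/seteqP; split=> // x FB; have [Fx _] := FB 0%N I.
  have x0 : 0 <= x by move: (Fu _ Fx); rewrite /unit_itv/= in_itv/= => /andP[].
  have /nbhs_ballP[r /= r0 rU] := open_nbhs_nbhs (conj oU (FU _ Fx)).
  have [m mr] := exp3V_lt r r0.
  have [_ nB] := FB m I; apply: nB; exists (idx m x); last exact: idx_cell.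
  move=> y cy; apply: rU; rewrite /ball/=.
  by apply: lt_trans mr; apply: cell_dist cy; exact: idx_cell.
have : @lebesgue_measure R (F `\` B m) @[m --> \oo] --> @lebesgue_measure R (\bigcap_m (F `\` B m)).
  apply: nonincreasing_cvg_mu => //.
  - apply: le_lt_trans (ltry 1); apply: le_trans F1; apply: le_measure; rewrite ?inE.
    + exact: mFB.
    + exact: mF.
    + exact: subDsetl.
  - by rewrite cap0; exact: measurable0.
  - apply/nonincreasing_seqP => m; apply/subsetPset; apply: setDS => x [k kU ck].
    have x0 := cell_ge0 _ _ _ ck.
    exists (idx m.+1 x); last exact: idx_cell.
    by move=> y /(cell_subset m x x0); rewrite (cell_idx _ _ _ ck); exact: kU.
rewrite cap0 measure0 => /fine_cvgP[finm /(cvgr_lt _)/(_ e e0) lte].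
have [m _ /(_ m (leqnn m)) [fm lm]] : \forall m \near \oo,
    @lebesgue_measure R (F `\` B m) \is a fin_num /\ fine (@lebesgue_measure R (F `\` B m)) < e.
  by near=> m; split; near: m.
by exists m; rewrite -(fineK fm) lte_fin.
Unshelve. all: by end_near. Qed.

(* Up to null sets [A] contains a Borel set [F] inside an open [U] with [U \ F]
   small; inside [U] the error is at most [U \ F], and the part of [F] not covered
   by cells inside [U] is small by [inner_cells_cvg]. *)
Lemma cell_union_approx A e : lebesgue_measurable A -> A `<=` @unit_itv R -> 0 < e ->
  exists m, \sum_(k < 3 ^ m) Num.min (density A m k) (1 - density A m k) * 3 ^- m < e.
Proof.
move=> mA AU e0.
have [F mF [N [B [mB B0 NB]] FNA]] : exists2 F, @measurable _ (measurableTypeR R) F &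
    exists2 N, (@lebesgue_measure R).-negligible N & F `|` N = A.
  move: mA; rewrite /lebesgue_measurable -completed_caratheodory_measurable.
  by rewrite g_sigma_completed_algebra_genE.
have FA : F `<=` A by rewrite -FNA; exact: subsetUl.
have Foo : (lebesgue_measure F < +oo)%E.
  apply: le_lt_trans (_ : lebesgue_measure (@unit_itv R) < +oo)%E.
    apply: le_measure; rewrite ?inE//; first exact: measurable_itv.
    exact: subset_trans AU.
  by rewrite lebesgue_measure_itv/= lte_fin ltr01 -EFinB ltry.
have e2 : 0 < e / 2 by rewrite divr_gt0.
have [U [oU FU UF]] := lebesgue_regularity_outer mF Foo e2.
have [m mFB] := inner_cells_cvg U F (e / 2) oU FU (subset_trans FA AU) mF e2.
exists m; set D := F `\` _ in mFB.
have mD : @measurable _ (measurableTypeR R) D.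
  by apply: measurableD => //; apply: bigcup_measurable => k _; exact: measurable_itv.
have mU : @measurable _ (measurableTypeR R) (U `\` F).
  by apply: measurableD => //; exact: open_measurable.
have lB := borel_lebesgue _ mB; have lD := borel_lebesgue _ mD; have lU := borel_lebesgue _ mU.
have lT : lebesgue_measurable [set: R] by exact: measurableT.
have cell_bound k : Num.min (density A m k) (1 - density A m k) <=
    density D m k + density B m k + density (U `\` F) m k.
  have := density_ge0 D m k; have := density_ge0 B m k; have := density_ge0 (U `\` F) m k.
  (* A cell inside [U] is filled by [A] up to [U \ F], which controls [1 - density]. Any other cell
     is disjoint from the inner cells of its level, so [A] meets it only within [D] and [B], which
     controls the density. *)
  have [kU|kU] := pselect ((cell m k : set R) `<=` U).
    have : density setT m k <= density A m k + density (U `\` F) m k.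
      apply: density_sub => // x [_ cx]; have [Ax|nA] := pselect (A x); first by left.
      by right; split; [exact: kU|move=> /FA].
    rewrite density_setT => h *; rewrite ge_min; apply/orP; right; lra.
  have : density A m k <= density D m k + density B m k.
    apply: density_sub => // x [+ cx]; rewrite -FNA => -[Fx|/NB]; last by right.
    left; split=> // -[j jU cj]; apply: kU.
    by rewrite -(cell_idx _ _ _ cx) (cell_idx _ _ _ cj).
  by move=> h *; rewrite ge_min; apply/orP; left; lra.
have small X c : lebesgue_measurable X -> (leb X < c%:E)%E -> density X 0 0 < c.
  by move=> mX Xc; rewrite -lte_fin; apply: le_lt_trans Xc; exact: density00_le.
have dD := small D _ lD mFB; have dU := small _ _ lU UF.
have dB : density B 0 0 <= 0.
  by rewrite -lee_fin; apply: le_trans (density00_le _ lB) _; rewrite (_ : leb B = 0)//.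
apply: le_lt_trans (_ : density D 0 0 + density B 0 0 + density (U `\` F) 0 0 < e); last lra.
rewrite -!(sum_density _ m)// -!big_split; apply: ler_sum => k _ /=.
have q0 : 0 <= 3 ^- m :> R by rewrite invr_ge0 exprn_ge0.
by have := ler_wpM2r q0 (cell_bound k); rewrite !mulrDl.
Qed.

(** Since [takagi] vanishes at 0 and 1, [takagi_modulus] bounds it by the distance of the density to
    the nearer endpoint plus [3 ^- n], and the mean of that distance is small by
    [cell_union_approx]. *)
Lemma potential_small A e : lebesgue_measurable A -> A `<=` @unit_itv R -> 0 < e ->
  exists m, potential A m < e.
Proof.
move=> mA AU e0; have [n ne] := exp3V_lt (e / 2) ltac:(by rewrite divr_gt0).
have d0 : 0 < e / (8 / 3 * n%:R + 1) by rewrite divr_gt0// ltr_wpDl// mulr_ge0.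
have [m me] := cell_union_approx A _ mA AU d0; exists m.
apply: le_lt_trans (_ : 4 / 3 * n%:R *
  (\sum_(k < 3 ^ m) Num.min (density A m k) (1 - density A m k) * 3 ^- m) + 3 ^- n < e); last first.
  move: me; rewrite ltr_pdivlMr ?ltr_wpDl ?mulr_ge0//.
  have : 0 <= \sum_(k < 3 ^ m) Num.min (density A m k) (1 - density A m k) * 3 ^- m.
    apply: sumr_ge0 => k _; rewrite mulr_ge0 ?invr_ge0 ?exprn_ge0//.
    by rewrite le_min density_ge0 subr_ge0 density_le1.
  by move: ne; move: (\sum_(_ < _) _) (3 ^- n) n%:R => d z M; lra.
have one : \sum_(k < 3 ^ m) 3 ^- m = 1 :> R.
  by rewrite sumr_const card_ord -[LHS]mulr_natl natrX divff// expf_neq0.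
have key k : takagi (density A m k) <=
    4 / 3 * n%:R * Num.min (density A m k) (1 - density A m k) + 3 ^- n.
  have /andP[a0 a1] := density01 A m k mA.
  case: (min_cases (density A m k) (1 - density A m k)) => -[-> _].
    by have := takagi_modulus n (density A m k) 0; rewrite takagi0 !subr0 !ger0_norm ?takagi_ge0.
  have := takagi_modulus n (1 - density A m k) 0.
  by rewrite takagi0 takagi_sym !subr0 !ger0_norm ?takagi_ge0// subr_ge0.
have -> : 3 ^- n = \sum_(k < 3 ^ m) 3 ^- n * 3 ^- m :> R by rewrite -mulr_sumr one mulr1.
rewrite mulr_sumr -big_split; apply: ler_sum => k _ /=.
have q0 : 0 <= 3 ^- m :> R by rewrite invr_ge0 exprn_ge0.
by have := ler_wpM2r q0 (key k); rewrite [X in _ <= X -> _]mulrDl -!mulrA.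
Qed.

Lemma takagi_le_norm1 A x : lebesgue_measurable A -> A `<=` @unit_itv R -> leb A = x%:E ->
  ((takagi x)%:E <= norm1 (S1 \1_A))%E.
Proof.
move=> mA AU Ax; rewrite norm1_S1//.
have -> : takagi x = potential A 0.
  rewrite /potential expn0 big_ord_recl big_ord0 expr0 invr1 mulr1 addr0.
  by move: Ax; rewrite leb_density00// => -[->].
apply/lee_addgt0Pr => e e0; have [m me] := potential_small A e mA AU e0.
apply: le_trans (_ : ((\sum_(0 <= i < m) variation A i)%:E + e%:E <= _)%E); last first.
  by rewrite leeD2r// -sumEFin nneseries_lim_ge// => *; rewrite lee_fin variation_ge0.
by rewrite -EFinD lee_fin; have := potential_le A m mA; lra.
Qed.

End VariationBounds.

(** * Initial segments are extremal *)

Section InitialSegment.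
Context {R : realType}.
Implicit Types (x : R) (m k : nat).
Local Notation leb := (@completed_lebesgue_measure R).

Lemma lebesgue_measurable_initial x : lebesgue_measurable `[0, x[.
Proof. by apply: borel_lebesgue; exact: measurable_itv. Qed.

Lemma leb_initial x : 0 <= x -> leb `[0, x[ = x%:E.
Proof.
move=> x0; transitivity (@lebesgue_measure R `[0, x[) => //.
rewrite lebesgue_measure_itv/= lte_fin -EFinB subr0; case: ltP => // xle.
by congr EFin; apply/eqP; rewrite eq_le x0 xle.
Qed.

Lemma density_initial_lt x m k : 0 <= x -> (k < idx m x)%N -> density `[0, x[ m k = 1.
Proof.
move=> x0 km; rewrite /density setIidr ?leb_cell/= ?divff ?invr_neq0 ?expf_neq0//.
move=> y cy; rewrite /= in_itv/= (cell_ge0 _ _ _ cy)/=.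
move: cy; rewrite cellE => /andP[_ yk]; rewrite -(ltr_pM2l (exp3_gt0 m)).
apply: lt_le_trans yk _; have := idx_cell m _ x0; rewrite cellE => /andP[+ _].
by apply: le_trans; rewrite ler_nat.
Qed.

Lemma density_initial_gt x m k : 0 <= x -> (idx m x < k)%N -> density `[0, x[ m k = 0.
Proof.
move=> x0 km; rewrite /density (_ : _ `&` _ = set0) ?measure0 ?mul0r//.
apply/seteqP; split=> // y [+ cy]; rewrite /= in_itv/= => /andP[_ yx].
have : (idx m x).+1%:R <= k%:R :> R by rewrite ler_nat.
have := idx_cell m _ x0; rewrite cellE => /andP[_].
move: cy; rewrite cellE => /andP[+ _].
have := exp3_gt0 m; rewrite -(ltr_pM2l (exp3_gt0 m)) in yx => _; lra.
Qed.

Lemma density_initial_eq x m : 0 <= x ->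
  density `[0, x[ m (idx m x) = 3 ^+ m * x - (idx m x)%:R.
Proof.
move=> x0; have := idx_cell m _ x0; rewrite cellE => /andP[h1 h2].
have m0 := exp3_gt0 m : 0 < 3 ^+ m :> R.
have k0 : (idx m x)%:R / 3 ^+ m <= x by rewrite ler_pdivrMr// mulrC.
rewrite /density (_ : _ `&` _ = `[(idx m x)%:R / 3 ^+ m, x[%classic).
  rewrite (_ : leb _ = (x - (idx m x)%:R / 3 ^+ m)%:E)/=.
    by field; rewrite gt_eqF.
  transitivity (@lebesgue_measure R `[(idx m x)%:R / 3 ^+ m, x[) => //.
  rewrite lebesgue_measure_itv/= lte_fin -EFinB; case: ltP => // xle.
  by congr EFin; apply/esym/eqP; rewrite subr_eq0 eq_le k0 xle.
apply/seteqP; split=> y; rewrite /cell /= !in_itv/=.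
  by move=> [/andP[_ ->] /andP[-> _]].
move=> /andP[ky yx]; rewrite ky yx !andbT /=; split.
  by apply: le_trans ky; rewrite divr_ge0 ?exprn_ge0.
by apply: lt_trans yx _; rewrite ltr_pdivlMr// mulrC.
Qed.

Lemma frac_idx x m : 0 <= x -> frac (3 ^+ m * x) = 3 ^+ m * x - (idx m x)%:R.
Proof.
move=> x0; rewrite /Defs.frac (_ : Num.floor _ = (idx m x)%:Z)//.
apply: floor_def; have := idx_cell m _ x0; rewrite cellE.
by rewrite (_ : (_ + 1)%:~R = (idx m x).+1%:R :> R)// intrD -(natr1 (idx m x)).
Qed.

(** Cells left of the one containing [x] have density 1 and cells right of it have density 0, as do
    their children, so a single parent contributes. *)
Lemma variation_initial x m : 0 <= x < 1 ->
  variation `[0, x[ m = 3 ^- m * psi3 (frac (3 ^+ m * x)).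
Proof.
move=> /andP[x0 x1]; have ux : @unit_itv R x by rewrite /unit_itv/= in_itv/= x0.
have [Km _] := unit_idx m _ ux; have KE := idx_parent m _ x0.
have ltr3 := ltn_pmod (idx m.+1 x) (isT : 0 < 3)%N.
have K'E := divn_eq (idx m.+1 x) 3; rewrite -KE in K'E.
rewrite variationE (bigD1 (Ordinal Km))//= big1 ?addr0; last first.
  move=> k; rewrite -val_eqE/= => kK.
  have [kl|kg|/eqP] := ltngtP k (idx m x); last by rewrite (negbTE kK).
    by rewrite !density_initial_lt ?subrr ?normr0 ?addr0 ?mul0r//; lia.
  by rewrite !density_initial_gt ?subrr ?normr0 ?addr0 ?mul0r//; lia.
rewrite frac_idx// density_initial_eq//.
have [t0 t1] : 0 <= 3 ^+ m * x - (idx m x)%:R /\ 3 ^+ m * x - (idx m x)%:R < 1.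
  by have := frac_itv (3 ^+ m * x); rewrite frac_idx// => /andP[].
have [u0 u1] : 0 <= 3 ^+ m.+1 * x - (idx m.+1 x)%:R /\ 3 ^+ m.+1 * x - (idx m.+1 x)%:R < 1.
  by have := frac_itv (3 ^+ m.+1 * x); rewrite frac_idx// => /andP[].
have de := density_initial_eq x m.+1 x0.
have K'R : (idx m.+1 x)%:R = 3 * (idx m x)%:R + (idx m.+1 x %% 3)%:R :> R.
  by rewrite {1}K'E natrD natrM mulrC.
have tE : 3 ^+ m.+1 * x - (idx m.+1 x)%:R =
    3 * (3 ^+ m * x - (idx m x)%:R) - (idx m.+1 x %% 3)%:R by rewrite K'R exprS; ring.
rewrite tE in de u0 u1; rewrite exprS invfM.
move: (3 ^+ m * x - (idx m x)%:R) t0 t1 u0 u1 de {tE K'R} => t t0 t1 u0 u1 de.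
(* The next ternary digit of [x] decides whether the children have densities [(3t, 0, 0)],
   [(1, 3t - 1, 0)] or [(1, 1, 3t - 2)], where [t] is the density of the parent. *)
case: (idx m.+1 x %% 3)%N ltr3 K'E de u0 u1 => [|[|[|]]]// _ K'E de u0 u1.
- have -> : density `[0, x[ m.+1 (3 * idx m x) = 3 * t - 0%:R by rewrite -de K'E; congr density; lia.
  rewrite !density_initial_gt//; [|lia|lia].
  rewrite psi3_lower; last by apply/andP; split; lra.
  rewrite !sub0r !normrN !ger0_norm; [|lra|lra]; field.
  by rewrite expf_neq0.
- have -> : density `[0, x[ m.+1 (3 * idx m x + 1) = 3 * t - 1%:R by rewrite -de K'E; congr density; lia.
  rewrite density_initial_lt ?density_initial_gt//; [|lia|lia].
  rewrite psi3_middle; last by apply/andP; split; lra.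
  rewrite sub0r normrN (_ : 3 * t - 1 - t = 2 * (t - 2^-1)); last by field.
  rewrite normrM [`|2|]ger0_norm// [`|1 - t|]ger0_norm ?[`|t|]ger0_norm//; last lra.
  by move: `|_| => w; field; rewrite expf_neq0.
- have -> : density `[0, x[ m.+1 (3 * idx m x + 2) = 3 * t - 2%:R by rewrite -de K'E; congr density; lia.
  rewrite !density_initial_lt//; [|lia|lia].
  rewrite psi3_upper; last by apply/andP; split; lra.
  rewrite [`|1 - t|]ger0_norm ?[`|3 * t - 2 - t|]ler0_norm; [|lra|lra].
  by field; rewrite expf_neq0.
Qed.

Lemma norm1_initial x : 0 <= x <= 1 -> norm1 (S1 \1_(`[0, x[ : set R)) = T3 x.
Proof.
move=> /andP[x0]; rewrite norm1_S1; last exact: lebesgue_measurable_initial.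
(* The point 1 lies in no cell of the unit interval and is treated apart: there all densities are 1
   and [T3] vanishes. *)
rewrite le_eqVlt => /orP[/eqP ->|x1]; last first.
  by apply: eq_eseriesr => m _; rewrite variation_initial ?x0.
rewrite T3E takagi1; apply: eseries0 => m _ _; rewrite /variation big1// => k _.
have d1 n j : (j < 3 ^ n)%N -> density `[0, 1[ n j = 1 :> R.
  move=> jn; rewrite /density setIidr ?leb_cell/= ?divff ?invr_neq0 ?expf_neq0//.
  by move=> y; exact: cell_unit.
by rewrite !d1 ?subrr ?normr0 ?mul0r// ltn_divLR// -expnSr.
Qed.

End InitialSegment.

Theorem theorem2p3 (R : realType) :
  [/\ forall x : R, 0 <= x <= 1 -> inf_variation x = T3 x,
      forall x : R, 0 <= x <= 1 -> B113 x = T3 x &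
      exists c C : R, [/\ 0 < c, c <= C &
        forall x : R, 0 < x < 1 ->
          let xs := Num.min x (1 - x) in
          ((c * (xs * ln (1 / xs)))%:E <= T3 x)%E /\
          (T3 x <= (C * (xs * ln (1 / xs)))%:E)%E]].
Proof.
split=> [x x01|x|]; last 2 first.
- exact: B113_takagi.
- have [c [C [c0 cC bnd]]] := @takagi_entropy R; exists c, C; split=> // x /andP[x0 x1] xs.
  have -> : T3 x = (takagi xs)%:E.
    by rewrite T3E /xs; case: (min_cases x (1 - x)) => -[-> _]; rewrite ?takagi_sym.
  rewrite !lee_fin; apply: bnd.
  by rewrite /xs; case: (min_cases x (1 - x)) => -[-> ?]; apply/andP; split; lra.
apply/eqP; rewrite eq_le; apply/andP; split.
  apply: ereal_inf_lbound; exists `[0, x[%classic; last exact: norm1_initial.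
  have /andP[x0 x1] := x01; split; [exact: lebesgue_measurable_initial| |exact: leb_initial].
  by move=> y; rewrite /unit_itv/= !in_itv/= => /andP[-> yx]; exact: lt_le_trans yx x1.
by apply: le_ereal_inf_tmp => _ [A [mA AU Ax] <-]; rewrite T3E takagi_le_norm1.
Qed.
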